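(* Let $R$ be an Arf local ring with maximal ideal $\mathfrak{m}$. Then the following hold. (a) For an $\mathfrak{m}$-primary ideal $I$ of $R$, the following conditions are equivalent: (i) $I$ is reflexive as an $R$-module; (ii) $I$ is isomorphic (as an $R$-module) to some trace ideal of $R$; (iii) $I$ is isomorphic (as an $R$-module) to some integrally closed ideal of $R$. (b) Suppose that the integral closure $\overline{R}$ of $R$ is a local ring. Then every reflexive $R$-module with positive rank is isomorphic to a direct sum of $\mathfrak{m}$-primary integrally closed ideals of $R$.
   Context: All rings are commutative and Noetherian, and all modules are finitely generated. For a ring $R$, $\mathrm{Q}(R)$ denotes the total ring of fractions of $R$ and $\overline{R}$ denotes the integral closure of $R$ in $\mathrm{Q}(R)$. For an ideal $I$, $\overline{I}$ denotes the integral closure of $I$ in $R$; $I$ is integrally closed if $I=\overline{I}$. Arf ring: let $R$ be a Cohen-Macaulay semi-local ring with $\dim R_{\mathfrak{n}}=1$ for all maximal ideals $\mathfrak{n}$. $R$ is an Arf ring if (1) for every integrally closed ideal $I$ containing a non-zerodivisor of $R$ there exists $a\in I$ such that $I=\overline{(a)}$, i.e. $I^{n+1}=aI^n$ for some $n\ge 0$; and (2) if $x,y,z\in R$ are such that $x$ is a non-zerodivisor of $R$ and $\frac{y}{x},\frac{z}{x}\in\overline{R}$, then $\frac{yz}{x}\in R$. (Equivalently, by a theorem of Lipman: for every integrally closed ideal $I$ containing a non-zerodivisor of $R$ there exists $a\in I$ with $I^2=aI$.) An Arf local ring is an Arf ring that is local. Reflexive: write $M^*=\operatorname{Hom}_R(M,R)$.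 An $R$-module $M$ is reflexive if the canonical map $M\to M^{**}$, $x\mapsto (f\mapsto f(x))$, is bijective. Trace ideal: $\operatorname{tr}_R(M)=\sum_{f\in M^*}\operatorname{Im} f\subseteq R$; an ideal is a trace ideal if it equals $\operatorname{tr}_R(M)$ for some $R$-module $M$. Rank: $M$ has rank $\ell$ (a non-negative integer) if $M_{\mathfrak{p}}$ is a free $R_{\mathfrak{p}}$-module of rank $\ell$ for all $\mathfrak{p}\in\operatorname{Ass} R$; $M$ has positive rank if it has rank $\ell$ for some $\ell>0$.
   Formalization: In (b) the summands are integrally closed ideals that are either m-primary or equal to R itself; with proper m-primary ideals only, the claim fails for R = k[[t^2,t^3]] and the reflexive module M = R. *)

(* Defs.v *)
From HB Require Import structures.
From mathcomp Require Import all_boot all_algebra.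
From mathcomp Require Import boolp classical_sets functions ring.

Set Implicit Arguments.
Unset Strict Implicit.
Unset Printing Implicit Defensive.

Import GRing.Theory.
Local Open Scope ring_scope.
Local Open Scope quotient_scope.

(* Ideals are (possibly improper) submodules of the regular module.  Their
   membership predicate is boolean; classically this is no restriction. *)
Notation ideal A := (submodClosed A^o).

Section Submodules.
Variables (R : comNzRingType) (V : lmodType R) (W : submodClosed V).

Record submod := Submod { submod_val :> V; _ : submod_val \in W }.

HB.instance Definition _ := [isSub for submod_val].
HB.instance Definition _ := [Choice of submod by <:].
HB.instance Definition _ := [SubChoice_isSubLmodule of submod by <:].

End Submodules.

Section Modules.
Variable R : comNzRingType.
Implicit Types M N : lmodType R.

Definition module_iso M N := exists f : {linear M -> N}, bijective f.

Definition fin_gen M :=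
  exists n (g : 'I_n -> M), forall x, exists c : 'I_n -> R,
    x = \sum_i c i *: g i.

Definition free_of_rank M (n : nat) := module_iso M 'rV[R]_n.

Section Dual.
Variable M : lmodType R.

Definition dual_pred : {pred (M -> R^o)} := fun f => `[< linear f >].

Lemma dual_subproof : submod_closed dual_pred.
Proof.
split=> [|a f g /asboolP lf /asboolP lg]; apply/asboolP => k x y.
  by rewrite /= scaler0 addr0.
rewrite [LHS]/(a *: f (k *: x + y) + g (k *: x + y)) lf lg.
have aux (p q r s : R) :
    a * (k * p + q) + (k * r + s) = k * (a * p + r) + (a * q + s) by ring.
exact: aux.
Qed.
HB.instance Definition _ :=
  GRing.isSubmodClosed.Build R (M -> R^o) dual_pred dual_subproof.

Definition dual := submod dual_pred.
HB.instance Definition _ := GRing.Lmodule.on dual.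

Definition dual_app (f : dual) : M -> R^o := submod_val f.

End Dual.

Lemma bidual_subproof M (x : M) :
  (fun f : dual M => dual_app f x) \in @dual_pred (dual M).
Proof. by apply/asboolP. Qed.

Definition to_bidual M (x : M) : dual (dual M) := Submod (bidual_subproof x).

Definition reflexive_module M := bijective (@to_bidual M).

Definition trace M : set R := fun x : R =>
  exists n (f : 'I_n -> dual M) (y : 'I_n -> M),
    x = \sum_i dual_app (f i) (y i).

(* I_0 (+) ... (+) I_(n-1), realised inside R^n *)
Section DirectSum.
Variables (n : nat) (I : 'I_n -> ideal R).

Definition dsum : {pred 'rV[R]_n} := fun v => [forall i, v 0 i \in I i].

Lemma dsum_subproof : submod_closed dsum.
Proof.
split=> [|a u v /forallP Iu /forallP Iv]; apply/forallP => i; rewrite !mxE.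
  exact: rpred0.
by apply: rpredD => //; apply: (@rpredZ _ _ (I i)).
Qed.
HB.instance Definition _ :=
  GRing.isSubmodClosed.Build R 'rV[R]_n dsum dsum_subproof.

End DirectSum.

End Modules.

Definition noetherian (R : comNzRingType) :=
  forall I : ideal R, fin_gen (submod I).

Definition trace_ideal (R : comNzRingType) (I : ideal R) :=
  exists M : lmodType R, fin_gen M /\ forall x : R, x \in I <-> trace M x.

(* Since 0 is not in S, the ring S^-1 R is nonzero. *)
Record mult_set (R : comNzRingType) := MultSet {
  ms_pred :> {pred R};
  ms_closed : mulr_closed ms_pred;
  ms_neq0 : 0 \notin ms_pred }.

Section Localization.
Variables (R : comNzRingType) (S : mult_set R).

Definition denom := {s : R | s \in ms_pred S}.
Definition denom1 : denom := exist _ 1 (proj1 (ms_closed S)).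
Definition denomM (s t : denom) : denom :=
  exist _ (sval s * sval t) (proj2 (ms_closed S) _ _ (svalP s) (svalP t)).

Section LocModule.
Variable M : lmodType R.

Definition loc_rel : rel (M * denom) := fun x y =>
  `[< exists2 u, u \in ms_pred S &
      u *: (sval y.2 *: x.1) = u *: (sval x.2 *: y.1) >].

Lemma loc_rel_refl : reflexive loc_rel.
Proof. by move=> x; apply/asboolP; exists 1; rewrite ?(ms_closed S).1. Qed.

Lemma loc_rel_sym : symmetric loc_rel.
Proof. by move=> x y; apply/asboolP/asboolP => -[u Su e]; exists u. Qed.

Lemma loc_rel_trans : transitive loc_rel.
Proof.
move=> [y [b Sb]] [x [a Sa]] [z [c Sc]].
move=> /asboolP[u Su /= e1] /asboolP[v Sv /= e2]; apply/asboolP.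
have SM := (ms_closed S).2; exists (u * v * b) => /=.
  by rewrite !SM.
transitivity ((v * c) *: (u *: (b *: x))).
  by rewrite !scalerA; congr (_ *: _); ring.
rewrite e1; transitivity ((u * a) *: (v *: (c *: y))).
  by rewrite !scalerA; congr (_ *: _); ring.
by rewrite e2 !scalerA; congr (_ *: _); ring.
Qed.

Canonical loc_equiv := EquivRel loc_rel loc_rel_refl loc_rel_sym loc_rel_trans.

Definition locm := {eq_quot loc_rel}.
HB.instance Definition _ := Choice.on locm.
HB.instance Definition _ := EqQuotient.on locm.

Definition locfrac (x : M) (s : denom) : locm := \pi_locm (x, s).

Lemma locfracP (q : locm) : exists x s, q = locfrac x s.
Proof.
exists (repr q).1, (repr q).2.
by rewrite /locfrac -surjective_pairing reprK. Qed.

Lemma locfrac_eq x s y t : locfrac x s = locfrac y t <->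
  exists2 u, u \in ms_pred S & u *: (sval t *: x) = u *: (sval s *: y).
Proof.
split=> [/eqP | e]; rewrite /locfrac.
  by rewrite eqmodE => /asboolP.
by apply/eqP; rewrite eqmodE; apply/asboolP.
Qed.

Definition loc_add (p q : locm) : locm :=
  let x := repr p in let y := repr q in
  locfrac (sval y.2 *: x.1 + sval x.2 *: y.1) (denomM x.2 y.2).
Definition loc_opp (p : locm) : locm :=
  let x := repr p in locfrac (- x.1) x.2.
Definition loc_zero : locm := locfrac 0 denom1.

Lemma repr_locfrac x s : exists2 u, u \in ms_pred S &
  u *: (sval s *: (repr (locfrac x s)).1) = u *: (sval (repr (locfrac x s)).2 *: x).
Proof.
by apply/locfrac_eq; rewrite /locfrac -surjective_pairing reprK.
Qed.

Lemma loc_addE x s y t : loc_add (locfrac x s) (locfrac y t) =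
  locfrac (sval t *: x + sval s *: y) (denomM s t).
Proof.
rewrite /loc_add; have [u Su] := repr_locfrac x s.
have [v Sv] := repr_locfrac y t.
case: (repr _) => y' [t' St'] /=; case: (repr _) => x' [s' Ss'] /= e1 e2.
apply/locfrac_eq; exists (u * v) => /=; first by rewrite (ms_closed S).2.
rewrite !scalerDr !scalerA; congr (_ + _).
  transitivity ((u * v * sval t * t') *: (sval s *: x')).
    by rewrite !scalerA; congr (_ *: _); ring.
  transitivity ((v * sval t * t') *: (u *: (sval s *: x'))).
    by rewrite !scalerA; congr (_ *: _); ring.
  by rewrite e2 !scalerA; congr (_ *: _); ring.
transitivity ((u * sval s * s') *: (v *: (sval t *: y'))).
  by rewrite !scalerA; congr (_ *: _); ring.
by rewrite e1 !scalerA; congr (_ *: _); ring.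
Qed.

Lemma loc_oppE x s : loc_opp (locfrac x s) = locfrac (- x) s.
Proof.
rewrite /loc_opp; have [u Su] := repr_locfrac x s.
case: (repr _) => x' [s' Ss'] /= e; apply/locfrac_eq; exists u => //=.
by rewrite !scalerN e.
Qed.

Lemma loc_eq x s y t : sval t *: x = sval s *: y -> locfrac x s = locfrac y t.
Proof.
by move=> e; apply/locfrac_eq; exists 1; rewrite ?e ?(ms_closed S).1.
Qed.

Lemma loc_addA : associative loc_add.
Proof.
move=> p q r; have [x [s ->]] := locfracP p; have [y [t ->]] := locfracP q.
have [z [v ->]] := locfracP r; rewrite !loc_addE; apply: loc_eq => /=.
rewrite !scalerDr !scalerA addrA.
by congr (_ *: _ + _ *: _ + _ *: _); ring.
Qed.

Lemma loc_addC : commutative loc_add.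
Proof.
move=> p q; have [x [s ->]] := locfracP p; have [y [t ->]] := locfracP q.
by rewrite !loc_addE; apply: loc_eq; rewrite /= addrC [_ * sval s]mulrC.
Qed.

Lemma loc_add0 : left_id loc_zero loc_add.
Proof.
move=> p; have [x [s ->]] := locfracP p; rewrite loc_addE; apply: loc_eq.
by rewrite /= scaler0 add0r scale1r mul1r.
Qed.

Lemma loc_addN : left_inverse loc_zero loc_opp loc_add.
Proof.
move=> p; have [x [s ->]] := locfracP p; rewrite loc_oppE loc_addE.
by apply: loc_eq; rewrite /= scalerN addNr !scaler0.
Qed.

HB.instance Definition _ :=
  GRing.isZmodule.Build locm loc_addA loc_addC loc_add0 loc_addN.

End LocModule.

Definition locr := locm R^o.
HB.instance Definition _ := GRing.Zmodule.on locr.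

Definition loc_scale (M : lmodType R) (a : locr) (p : locm M) : locm M :=
  let c := repr a in let x := repr p in
  locfrac ((c.1 : R) *: x.1) (denomM c.2 x.2).

Lemma loc_scaleE (M : lmodType R) (a : R) s (x : M) t :
  loc_scale (locfrac (a : R^o) s) (locfrac x t) = locfrac (a *: x) (denomM s t).
Proof.
rewrite /loc_scale; have [u Su] := repr_locfrac (a : R^o) s.
have [v Sv] := repr_locfrac x t.
case: (repr _) => x' [t' St'] /=; case: (repr _) => a' [s' Ss'] /= e1.
rewrite /GRing.scale /= => e2.
apply/locfrac_eq; exists (u * v) => /=; first by rewrite (ms_closed S).2.
transitivity ((u * (sval s * a')) *: (v *: (sval t *: x'))).
  by rewrite !scalerA; congr (_ *: _); ring.
by rewrite e1 e2 !scalerA; congr (_ *: _); ring.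
Qed.

Lemma loc_addfE (M : lmodType R) (x : M) s y t :
  locfrac x s + locfrac y t = locfrac (sval t *: x + sval s *: y) (denomM s t).
Proof. exact: loc_addE. Qed.

Definition loc_mul : locr -> locr -> locr := @loc_scale R^o.
Definition loc_one : locr := locfrac (1 : R^o) denom1.

Lemma loc_scaleA (M : lmodType R) (a b : locr) (p : locm M) :
  loc_scale a (loc_scale b p) = loc_scale (loc_mul a b) p.
Proof.
have [c [s ->]] := locfracP a; have [d [t ->]] := locfracP b.
have [x [v ->]] := locfracP p.
have -> : loc_mul (locfrac c s) (locfrac d t) =
  locfrac ((c : R) *: d) (denomM s t) by exact: loc_scaleE.
rewrite (loc_scaleE d t x v) (loc_scaleE c s (d *: x)) loc_scaleE.
apply: loc_eq; rewrite /= !scalerA; congr (_ *: _).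
by rewrite /GRing.scale /=; ring.
Qed.

Lemma loc_scale1 (M : lmodType R) (p : locm M) : loc_scale loc_one p = p.
Proof.
have [x [s ->]] := locfracP p; rewrite /loc_one loc_scaleE.
by apply: loc_eq; rewrite /= scale1r mul1r.
Qed.

Lemma loc_scaleDr (M : lmodType R) (a : locr) :
  {morph @loc_scale M a : p q / p + q}.
Proof.
move=> p q; have [c [s ->]] := locfracP a; have [x [t ->]] := locfracP p.
have [y [v ->]] := locfracP q; rewrite loc_addfE !loc_scaleE loc_addfE.
apply: loc_eq => /=; rewrite !scalerDr !scalerA.
by congr (_ *: _ + _ *: _); ring.
Qed.

Lemma loc_scaleDl (M : lmodType R) (p : locm M) :
  {morph (fun a : locr => loc_scale a p) : a b / a + b}.
Proof.
move=> a b; have [c [s ->]] := locfracP a; have [d [t ->]] := locfracP b.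
have [x [v ->]] := locfracP p; rewrite [_ + _ in LHS]loc_addfE !loc_scaleE.
rewrite loc_addfE; apply: loc_eq => /=.
rewrite !scalerA -scalerDl !scalerA; congr (_ *: _).
by rewrite /GRing.scale /=; ring.
Qed.

Lemma loc_mulC : commutative loc_mul.
Proof.
move=> a b; have [c [s ->]] := locfracP a; have [d [t ->]] := locfracP b.
rewrite /loc_mul !loc_scaleE; apply: loc_eq => /=.
by rewrite /GRing.scale /=; ring.
Qed.

Lemma loc_mulA : associative loc_mul.
Proof. by move=> a b c; rewrite [LHS]loc_scaleA. Qed.

Lemma loc_mul1 : left_id loc_one loc_mul.
Proof. exact: loc_scale1. Qed.

Lemma loc_mulDl : left_distributive loc_mul +%R.
Proof. by move=> a b c; apply: loc_scaleDl. Qed.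

Lemma loc_one_neq0 : loc_one != 0 :> locr.
Proof.
apply/eqP => /locfrac_eq[u Su /=]; rewrite /GRing.scale /= !mul1r mulr0 mulr1.
by move=> u0; have := ms_neq0 S; rewrite -[X in X \notin _]u0 Su.
Qed.

HB.instance Definition _ := GRing.Zmodule_isComNzRing.Build locr
  loc_mulA loc_mulC loc_mul1 loc_mulDl loc_one_neq0.

HB.instance Definition _ (M : lmodType R) :=
  GRing.Zmodule_isLmodule.Build locr (locm M)
    (@loc_scaleA M) (@loc_scale1 M) (@loc_scaleDr M) (@loc_scaleDl M).

Definition to_loc (a : R) : locr := locfrac (a : R^o) denom1.

Lemma to_loc_zmod : zmod_morphism to_loc.
Proof.
move=> a b; have -> : - to_loc b = locfrac (- b : R^o) denom1.
  exact: loc_oppE.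
by rewrite [RHS]loc_addE; apply: loc_eq; rewrite /= !scale1r mul1r scale1r.
Qed.

Lemma to_loc_monoid : monoid_morphism to_loc.
Proof.
split=> // a b; rewrite [RHS]loc_scaleE; apply: loc_eq => /=.
by rewrite mul1r !scale1r.
Qed.

HB.instance Definition _ := GRing.isZmodMorphism.Build R locr to_loc to_loc_zmod.
HB.instance Definition _ :=
  GRing.isMonoidMorphism.Build R locr to_loc to_loc_monoid.

End Localization.

Section RingNotions.
Variable A : comNzRingType.
Implicit Types p m I J : ideal A.

Definition prime_ideal p := 1 \notin p /\ prime_idealr_closed (R := A) p.

Definition maximal_ideal m :=
  1 \notin m /\
  forall J, {subset m <= J} -> 1 \notin J -> {subset J <= m}.

Definition local_at m :=
  maximal_ideal m /\ forall J, maximal_ideal J -> J =i m.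

Definition local_ring := exists m, local_at m.

Definition semilocal :=
  exists n (m : 'I_n -> ideal A),
    forall J, maximal_ideal J -> exists i, J =i m i.

Definition prime_chain (d : nat) :=
  exists p : 'I_d.+1 -> ideal A,
    (forall i, prime_ideal (p i)) /\
    forall i j : 'I_d.+1, (i < j)%N ->
      {subset p i <= p j} /\ ~ {subset p j <= p i}.

Definition krull_dim (d : nat) := prime_chain d /\ ~ prime_chain d.+1.

Definition generated (s : seq A) : set A := fun x : A =>
  exists c : 'I_(size s) -> A, x = \sum_i c i * s`_i.

(* Regular sequences contained in m; for m proper, the condition A/(s) <> 0
   is automatic. *)
Definition regular_seq m (s : seq A) :=
  forall i, (i < size s)%N -> s`_i \in m /\
    forall x, generated (take i s) (s`_i * x) -> generated (take i s) x.

Definition depth m (d : nat) :=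
  (exists s, size s = d /\ regular_seq m s) /\
  forall s, regular_seq m s -> (size s <= d)%N.

Definition CM_local :=
  exists m d, [/\ local_at m, krull_dim d & depth m d].

Definition radical I : set A := fun x : A => exists n, x ^+ n \in I.

Definition primary_ideal I :=
  1 \notin I /\ forall x y : A, x * y \in I -> x \in I \/ radical I y.

Definition m_primary m I :=
  primary_ideal I /\ forall x : A, x \in m <-> radical I x.

(* The unit ideal has to be admitted among the summands of a reflexive module:
   over k[[t^2, t^3]], an Arf ring with integral closure k[[t]], no proper
   integrally closed ideal is isomorphic to the free module of rank 1. *)
Definition m_primary_or_unit m I := m_primary m I \/ forall x : A, x \in I.

Definition ideal_mul (B C : set A) : set A := fun x : A =>
  exists n (b c : 'I_n -> A),
    (forall i, B (b i) /\ C (c i)) /\ x = \sum_i b i * c i.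

Fixpoint ideal_pow (B : set A) (n : nat) : set A :=
  if n is k.+1 then ideal_mul B (ideal_pow B k) else setT.

(* x ^+ n + a_1 x ^+ (n - 1) + ... + a_n = 0, where a_(i + 1), which belongs to
   B ^ (i + 1), is written a i. *)
Definition int_closure (B : set A) : set A := fun x : A =>
  exists n (a : 'I_n -> A), [/\ (0 < n)%N,
    forall i : 'I_n, ideal_pow B i.+1 (a i) &
    x ^+ n + \sum_(i < n) a i * x ^+ (n - i.+1) = 0].

Definition carrier I : set A := fun x : A => x \in I.

Definition integrally_closed I := carrier I = int_closure (carrier I).

Definition principal (a : A) : set A := fun x : A => exists r, x = a * r.

End RingNotions.

Section PrimeLocalization.
Variables (R : comNzRingType) (p : ideal R) (pp : prime_ideal p).

Definition compl_pred : {pred R} := fun s => s \notin p.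

Lemma compl_closed : mulr_closed compl_pred.
Proof.
case: pp => p1 pM; split=> // x y xp yp; apply/negP => /pM.
by rewrite (negPf xp) (negPf yp).
Qed.

Lemma compl_neq0 : 0 \notin compl_pred.
Proof. by rewrite negbK (rpred0 p). Qed.

Definition compl : mult_set R := MultSet compl_closed compl_neq0.

End PrimeLocalization.

Section Rank.
Variables (R : comNzRingType) (M : lmodType R).

Definition associated (p : ideal R) :=
  exists x : R, forall a : R, a \in p <-> a * x = 0.

Definition has_rank (l : nat) :=
  forall (p : ideal R) (pp : prime_ideal p), associated p ->
    free_of_rank (locm (compl pp) M) l.

Definition positive_rank := exists2 l : nat, (0 < l)%N & has_rank l.

End Rank.

Section IntegralClosure.
Variable R : comNzRingType.

Definition nzd_pred : {pred R} := fun s => `[< GRing.lreg s >].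

Lemma nzd_closed : mulr_closed nzd_pred.
Proof.
split=> [|x y /asboolP xr /asboolP yr]; apply/asboolP; first exact: lreg1.
exact: lregM.
Qed.

Lemma nzd_neq0 : 0 \notin nzd_pred.
Proof.
apply/negP => /asboolP r0; have := oner_eq0 R.
by rewrite (r0 1 0) ?eqxx // !mul0r.
Qed.

Definition nzd : mult_set R := MultSet nzd_closed nzd_neq0.

(* Q(R) *)
Definition total_frac := locr nzd.
HB.instance Definition _ := GRing.ComNzRing.on total_frac.

Definition to_frac : R -> total_frac := @to_loc R nzd.
HB.instance Definition _ := GRing.RMorphism.on to_frac.

Definition qfrac (y : R) (x : denom nzd) : total_frac := locfrac (y : R^o) x.

Definition int_pred : {pred total_frac} := fun q => `[< integralOver to_frac q >].

Lemma int_pred_closed : subring_closed int_pred.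
Proof.
split=> [|x y /asboolP Ix /asboolP Iy|x y /asboolP Ix /asboolP Iy];
  apply/asboolP; [exact: integral1 | exact: integral_sub | exact: integral_mul].
Qed.
HB.instance Definition _ :=
  GRing.isSubringClosed.Build total_frac int_pred int_pred_closed.

(* The integral closure of R in Q(R), as a ring *)
Record int_ring := IntRing { int_val :> total_frac; _ : int_val \in int_pred }.

HB.instance Definition _ := [isSub for int_val].
HB.instance Definition _ := [Choice of int_ring by <:].
HB.instance Definition _ := [SubChoice_isSubComNzRing of int_ring by <:].

End IntegralClosure.

Definition cohen_macaulay (R : comNzRingType) :=
  forall (n : ideal R) (pn : prime_ideal n), maximal_ideal n ->
    CM_local (locr (compl pn)).

Record arf_ring (R : comNzRingType) : Prop := ArfRing {
  arf_semilocal : semilocal R;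
  arf_cohen_macaulay : cohen_macaulay R;
  arf_dim1 : forall (n : ideal R) (pn : prime_ideal n), maximal_ideal n ->
    krull_dim (locr (compl pn)) 1;
  arf_reduction : forall I : ideal R, integrally_closed I ->
    (exists2 x : R, x \in I & GRing.lreg x) ->
    exists2 a : R, a \in I & carrier I = int_closure (principal a);
  arf_quotient : forall (x : denom (nzd R)) (y z : R),
    qfrac y x \in @int_pred R -> qfrac z x \in @int_pred R ->
    exists r : R, qfrac (y * z) x = to_frac r }.

(* Main.v *)
(* Let [T] be a regular ideal of an Arf ring [R].  Its integral closure [C] has a
   reduction [c] with [C ^ 2 = c C], so multiplication by [y / c] with [y] in [C]
   maps [T] into [R].  If [T] is a trace ideal, it maps [T] into [T]; dividing an
   integral equation of [c] over [T] by a power of [c] gives [c] in [T], whence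
   [T = C].  Conversely an integrally closed regular [J = a B], where [B] is the
   ring [a^-1 J], is isomorphic to its trace [C = c B], which is the conductor
   [R : B]; and [R : (R : B) = R : c B = B], so that [J] is reflexive.

   Let [M] be reflexive with regular trace [T = t B].  Then [M = Hom (M^*, T)] is
   a [B]-module.  As [B] is semilocal and [T] is the sum of the images of the
   linear forms on [M], one form [f] maps [M] onto [T], which is free over [B],
   hence [M = T (+) ker f].  For [M] an ideal, [ker f = 0].  If [M] has a rank
   and the integral closure of [R] is local, then the zero-divisors of [R] are
   nilpotent and form the only associated prime, so that [ker f] has the rank of
   [M] minus one, and one concludes by induction. *)
From HB Require Import structures.
Require Import Defs.
From mathcomp Require Import all_boot all_algebra.
From mathcomp Require Import boolp classical_sets functions ring.

Set Implicit Arguments.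
Unset Strict Implicit.
Unset Printing Implicit Defensive.

Import GRing.Theory.
Local Open Scope ring_scope.

(** * Ideals avoiding a multiplicative set *)

Lemma inj_surj_bij (A B : Type) (f : A -> B) :
  injective f -> (forall y, exists x, f x = y) -> bijective f.
Proof. by move=> fI /choice[g gK]; exists g => // x; apply: fI; rewrite gK. Qed.

Definition is_ideal (R : comNzRingType) (A : set R) :=
  A 0 /\ forall a x y : R, A x -> A y -> A (a * x + y).

Section IdealOfSet.
Variables (R : comNzRingType) (A : set R) (idA : is_ideal A).

Definition ideal_pred : {pred R^o} := fun x => `[< A x >].

Lemma ideal_pred_closed : submod_closed ideal_pred.
Proof.
case: idA => A0 AD; split=> [|a x y /asboolP Ax /asboolP Ay]; apply/asboolP => //.
exact: AD.
Qed.
HB.instance Definition _ :=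
  GRing.isSubmodClosed.Build R R^o ideal_pred ideal_pred_closed.

Definition mk_ideal : ideal R := ideal_pred.

Lemma mk_idealP (x : R) : reflect (A x) (x \in mk_ideal).
Proof. exact: asboolP. Qed.

End IdealOfSet.

Section Ideals.
Variable R : comNzRingType.
Implicit Types (A B S : set R) (I J p : ideal R).

Lemma carrier_ideal I : is_ideal (carrier I).
Proof.
split=> [|a x y Ix Iy]; first exact: (rpred0 I).
rewrite /carrier; apply: (@rpredD R^o I) => //; exact: (@rpredZ R R^o I).
Qed.

Lemma ideal0 A : is_ideal A -> A 0. Proof. by case. Qed.

Lemma idealD A x y : is_ideal A -> A x -> A y -> A (x + y).
Proof. by move=> [_ AD] Ax Ay; rewrite -[x]mul1r; apply: AD. Qed.

Lemma idealM A a x : is_ideal A -> A x -> A (a * x).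
Proof. by move=> [A0 AD] Ax; rewrite -[_ * _]addr0; apply: AD. Qed.

Lemma idealMr A a x : is_ideal A -> A x -> A (x * a).
Proof. by rewrite mulrC; apply: idealM. Qed.

Lemma idealN A x : is_ideal A -> A x -> A (- x).
Proof. by rewrite -mulN1r; apply: idealM. Qed.

Lemma idealB A x y : is_ideal A -> A x -> A y -> A (x - y).
Proof. by move=> idA Ax Ay; apply: idealD => //; apply: idealN. Qed.

Lemma ideal_sum A (T : finType) (P : pred T) (f : T -> R) : is_ideal A ->
  (forall i, P i -> A (f i)) -> A (\sum_(i | P i) f i).
Proof.
move=> idA Af; elim/big_ind: _ => //; first exact: ideal0.
by move=> x y; apply: idealD.
Qed.

Lemma carrier_mk_ideal A (idA : is_ideal A) : carrier (mk_ideal idA) = A.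
Proof.
by apply/seteqP; split=> x /(mk_idealP idA).
Qed.

Definition ideal_adjoin A (a : R) : set R :=
  fun x => exists2 y, A y & exists r, x = y + r * a.

Lemma ideal_adjoin_ideal A a : is_ideal A -> is_ideal (ideal_adjoin A a).
Proof.
move=> idA; split.
  by exists 0; [exact: ideal0 | exists 0; rewrite mul0r addr0].
move=> b _ _ [y Ay [r ->]] [z Az [s ->]]; exists (b * y + z).
  by apply: idealD => //; apply: idealM.
by exists (b * r + s); ring.
Qed.

Lemma ideal_adjoin_sub A a : (A `<=` ideal_adjoin A a)%classic.
Proof. by move=> x Ax; exists x => //; exists 0; rewrite mul0r addr0. Qed.

Lemma ideal_adjoin_mem A a : is_ideal A -> ideal_adjoin A a a.
Proof. by move=> /ideal0 A0; exists 0 => //; exists 1; rewrite mul1r add0r. Qed.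

Lemma principal_ideal (a : R) : is_ideal (principal a).
Proof.
split=> [|b _ _ [r ->] [s ->]]; first by exists 0; rewrite mulr0.
by exists (b * r + s); ring.
Qed.

Lemma zero_ideal : @is_ideal R [set 0]%classic.
Proof. by split=> // a _ _ -> ->; rewrite mulr0 addr0. Qed.

Section Krull.
Variables (J S : set R).
Hypotheses (idJ : is_ideal J) (JS : forall x, J x -> ~ S x).

Lemma ideal_maximal_avoiding : exists p : ideal R,
  [/\ (J `<=` carrier p)%classic, forall x, x \in p -> ~ S x &
   forall K : ideal R, {subset p <= K} -> (forall x, x \in K -> ~ S x) ->
     {subset K <= p}].
Proof.
pose good A := [/\ is_ideal A, (J `<=` A)%classic & forall x, A x -> ~ S x].
have [F FP totF|A [[A0|gA] maxA]] :=
    @Zorn_bigcup R (fun A => A = set0 \/ good A).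
- have [[A0 FA0 gA0]|noA] := pselect (exists2 A, F A & good A); last first.
    left; apply/seteqP; split=> // x [A FA Ax].
    by case: (FP A FA) => [A_0|gA]; [rewrite A_0 in Ax | apply: noA; exists A].
  have gF A x : F A -> A x -> good A.
    by move=> FA Ax; case: (FP A FA) => // A_0; rewrite A_0 in Ax.
  right; split.
  + split=> [|a x y [A FA Ax] [B FB By]].
      by exists A0 => //; case: gA0 => /ideal0.
    have [AB|BA] := totF A B FA FB.
      exists B => //; have [idB _ _] := gF B y FB By.
      by apply: idealD => //; apply: idealM => //; apply: AB.
    exists A => //; have [idA _ _] := gF A x FA Ax.
    by apply: idealD; [|apply: idealM|apply: BA].
  + by move=> x Jx; exists A0 => //; case: gA0 => _ JA _; apply: JA.
  + by move=> x [A FA Ax]; case: (gF A x FA Ax) => _ _; apply.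
- case: (maxA J); last by right; split.
  rewrite A0; split; first by move=> x.
  by move=> /(_ 0 (ideal0 idJ)).
have [idA JA AS] := gA; exists (mk_ideal idA); split.
- by rewrite carrier_mk_ideal.
- by move=> x /(mk_idealP idA); apply: AS.
move=> K AK KS x Kx; apply/(mk_idealP idA); apply: contrapT => nAx.
apply: (maxA (carrier K)).
  split; first by move=> y Ay; apply: AK; apply/(mk_idealP idA).
  by move=> /(_ x Kx).
right; split=> //; first exact: carrier_ideal.
by move=> y /JA Ay; apply: AK; apply/(mk_idealP idA).
Qed.

Hypotheses (S1 : S 1) (SM : forall x y, S x -> S y -> S (x * y)).

(** An ideal [p] maximal among those avoiding [S] is prime: if [x] and [y] lie outside [p], both
    [p + (x)] and [p + (y)] meet [S]. The product of the two elements found lies in [S], but would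
    lie in [p] if [x * y] did. *)
Lemma prime_ideal_avoiding : exists p : ideal R,
  [/\ prime_ideal p, (J `<=` carrier p)%classic & forall x, x \in p -> ~ S x].
Proof.
have [p [Jp pS maxp]] := ideal_maximal_avoiding.
exists p; split=> //; split; first by apply/negP => p1; apply: (pS 1 p1 S1).
move=> x y pxy; apply: contrapT => /negP; rewrite negb_or.
case/andP=> px py; have idp := carrier_ideal p.
have adj z : z \notin p -> exists2 q, q \in p & exists r, S (q + r * z).
  move=> pz; have idz := ideal_adjoin_ideal z idp.
  have [noS|] := pselect (forall w, ideal_adjoin (carrier p) z w -> ~ S w).
    case/negP: pz; apply: (maxp (mk_ideal idz)).
    - by move=> w pw; apply/(mk_idealP idz)/ideal_adjoin_sub.
    - by move=> w /(mk_idealP idz); apply: noS.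
    by apply/(mk_idealP idz)/ideal_adjoin_mem.
  move=> /existsNP[w /not_implyP[[q pq [r ->]] /contrapT Sw]].
  by exists q => //; exists r.
have [q pq [r Sr]] := adj x px; have [q' pq' [r' Sr']] := adj y py.
apply: (pS ((q + r * x) * (q' + r' * y))); last exact: SM.
have -> : (q + r * x) * (q' + r' * y) =
    (q' + r' * y) * q + (r * x * q' + r * r' * (x * y)) by ring.
by apply: (idealD idp); [|apply: (idealD idp)]; apply: (idealM _ idp).
Qed.

End Krull.

Lemma maximal_ideal_above A : is_ideal A -> ~ A 1 ->
  exists2 p : ideal R, maximal_ideal p & (A `<=` carrier p)%classic.
Proof.
move=> idA A1; have [|p [Ap p1 maxp]] := @ideal_maximal_avoiding A [set 1] idA.
  by move=> x Ax x1; apply: A1; rewrite -[1]x1.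
exists p => //; split; first by apply/negP => /p1; apply.
move=> J pJ J1; apply: maxp => // x Jx x1; case/negP: J1.
by rewrite -[1]x1.
Qed.

Lemma maximal_adjoin p (x : R) : maximal_ideal p -> x \notin p ->
  exists2 y, y \in p & exists r, y + r * x = 1.
Proof.
move=> [p1 maxp] px; have idp := carrier_ideal p.
have idz := ideal_adjoin_ideal x idp.
have [|noS] := pselect (ideal_adjoin (carrier p) x 1).
  by case=> y py [r ->]; exists y => //; exists r.
case/negP: px; apply: (maxp (mk_ideal idz)).
- by move=> w pw; apply/(mk_idealP idz)/ideal_adjoin_sub.
- by apply/negP => /(mk_idealP idz).
by apply/(mk_idealP idz)/ideal_adjoin_mem.
Qed.

Lemma maximal_prime p : maximal_ideal p -> prime_ideal p.
Proof.
move=> maxp; split; first by case: maxp.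
move=> x y pxy; have [//|px] := boolP (x \in p); apply/orP; right.
have [z pz [r e]] := maximal_adjoin maxp px; have idp := carrier_ideal p.
rewrite -[y]mul1r -e.
have -> : (z + r * x) * y = y * z + r * (x * y) by ring.
by apply: (idealD idp); apply: idealM.
Qed.

Lemma local_unit m (x : R) : local_at m -> x \notin m -> exists y, x * y = 1.
Proof.
move=> [maxm locm] mx; apply: contrapT => nu.
have [|p maxp xp] := maximal_ideal_above (principal_ideal x).
  by case=> y e; apply: nu; exists y.
case/negP: mx; rewrite -(locm p maxp).
by apply: xp; exists 1; rewrite mulr1.
Qed.

Lemma local_nonunit m (x : R) : local_at m -> x \in m -> ~ exists y, x * y = 1.
Proof.
move=> [[m1 _] _] mx [y e]; case/negP: m1; rewrite -e.
exact: (idealMr y (carrier_ideal m) mx).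
Qed.

End Ideals.

(** * Arf local rings have a regular element and no chain of three primes *)

(** Carries the dimension bound, which [arf_ring] imposes on localizations, back to [R]: for local
    [R] the map [to_loc] at [m] is bijective. *)
Lemma prime_chain_iso (A B : comNzRingType) (f : {rmorphism A -> B}) (d : nat) :
  bijective f -> prime_chain A d -> prime_chain B d.
Proof.
case=> g fK gK [p [pp pchain]].
have gD a x y : g (a * x + y) = g a * g x + g y.
  by apply: (can_inj fK); rewrite rmorphD rmorphM !gK.
have idg i : @is_ideal B (fun q => g q \in p i).
  have idp := carrier_ideal (p i); split=> [|a x y px py].
    by rewrite -(rmorph0 f) fK; apply: (ideal0 idp).
  by rewrite gD; apply: (idealD idp) => //; apply: (idealM _ idp).
have inP i q : (q \in mk_ideal (idg i)) = (g q \in p i).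
  by apply/(mk_idealP (idg i))/idP.
exists (fun i => mk_ideal (idg i)); split=> [i|i j ij].
  have [p1 pM] := pp i; split; first by rewrite inP -(rmorph1 f) fK.
  move=> x y; rewrite !inP => pxy; apply: pM.
  by rewrite -[X in X \in _]fK rmorphM !gK.
have [sij nji] := pchain i j ij; split=> [q|sub].
  by rewrite !inP; apply: sij.
by apply: nji => x px; have := sub (f x); rewrite !inP fK; apply.
Qed.

Section LocalDimension.
Variables (R : comNzRingType) (m : ideal R) (localR : local_at m).
Let pm : prime_ideal m := maximal_prime localR.1.

Lemma local_compl_unit (s : denom (compl pm)) : exists t, sval s * t = 1.
Proof. by case: s => s ms /=; apply: local_unit ms. Qed.


Lemma to_loc_inj : injective (@to_loc R (compl pm)).
Proof.
move=> x y /locfrac_eq[u /(local_unit localR)[v uv]]; rewrite /= !scale1r.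
by move=> e; rewrite -[x]mul1r -[y]mul1r -uv ![u * v]mulrC -!mulrA; congr (v * _).
Qed.

Lemma to_loc_surj q : exists x, q = @to_loc R (compl pm) x.
Proof.
have [x [s ->]] := locfracP q; have [t st] := local_compl_unit s.
exists (t * x); apply: loc_eq; rewrite /= scale1r scalerA st scale1r //.
Qed.

Lemma to_loc_bij : bijective (@to_loc R (compl pm)).
Proof.
apply: inj_surj_bij to_loc_inj _ => q.
by have [x ->] := to_loc_surj q; exists x.
Qed.

Hypothesis arfR : arf_ring R.

Lemma arf_no_prime_chain2 : ~ prime_chain R 2.
Proof.
have [_ nchain] := arf_dim1 arfR pm localR.1.
by move/(prime_chain_iso (f := @to_loc R (compl pm)) to_loc_bij).
Qed.

(** The localization at [m] is a copy of [R], of positive dimension and of depth equal to its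
    dimension; the first term of a regular sequence is the element sought. *)
Lemma arf_regular_element : exists2 x, x \in m & GRing.lreg x.
Proof.
have [chain1 _] := arf_dim1 arfR pm localR.1.
have [m' [d [locm' [_ nchain] [[s [sz reg]] _]]]] :=
  arf_cohen_macaulay arfR pm localR.1.
(* For [d = 0], [nchain] would deny the chain [chain1]. *)
have d_gt0 : (0 < size s)%N by rewrite sz; case: d nchain {sz}.
have [m's regs] := reg 0%N d_gt0; have [a sa] := to_loc_surj s`_0.
exists a.
  apply: contrapT => /negP/(local_unit localR)[b ab].
  apply: (local_nonunit locm' m's); exists (@to_loc R (compl pm) b).
  by rewrite sa -rmorphM ab rmorph1.
move=> x y axy; apply/eqP; rewrite -subr_eq0; apply/eqP/to_loc_inj.
rewrite take0 in regs; rewrite rmorph0.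
suff: generated [::] (@to_loc R (compl pm) (x - y)).
  by case=> c ->; rewrite big_ord0.
apply: regs; exists (fun _ => 0); rewrite big_ord0 sa -rmorphM mulrBr.
by rewrite [a * x]axy subrr rmorph0.
Qed.

(** Otherwise [q], [p] and [m] would form a strict chain of three primes. *)
Lemma prime_above_prime (q p : ideal R) : prime_ideal q -> prime_ideal p ->
  {subset q <= p} -> ~ {subset p <= q} -> {subset m <= p}.
Proof.
move=> pq pp sqp npq y my; apply: contrapT => /negP py.
apply: arf_no_prime_chain2.
pose c (i : 'I_3) := if i == 0 :> nat then q else if i == 1%N :> nat then p else m.
have spm : {subset p <= m}.
  move=> z pz; apply: contrapT => /negP/(local_unit localR)[u zu].
  case: pp => /negP p1 _; apply: p1; rewrite -zu.
  exact: (idealMr u (carrier_ideal p) pz).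
have nmp : ~ {subset m <= p} by move=> /(_ y my); apply/negP.
exists c; split.
  by move=> [[|[|[|//]]] ?]; rewrite /c //=; apply: maximal_prime localR.1.
move=> [[|[|[|//]]] ?] [[|[|[|//]]] ?] //= _; split=> //.
- by move=> z /sqp/spm.
- by move=> mq; apply: nmp => z /mq/sqp.
Qed.

(* The products [s x ^ n] with [s] outside [p] avoid [0], which yields a prime
   ideal strictly inside [p]. *)
Lemma prime_above_regular (p : ideal R) (x : R) : prime_ideal p ->
  x \in p -> GRing.lreg x -> {subset m <= p}.
Proof.
move=> pp px regx.
pose S : set R := fun z => exists n, exists2 s, s \notin p & z = s * x ^+ n.
have [|||q [pq _ qS]] := @prime_ideal_avoiding R [set 0]%classic S (zero_ideal R).
- move=> _ -> [n [s ps /esym e]]; case/negP: ps.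
  suff -> : s = 0 by apply: (ideal0 (carrier_ideal p)).
  apply: (@lregX _ x n regx); rewrite mulr0.
  by rewrite /= mulrC.
- by exists 0%N, 1; rewrite ?mulr1 //; case: pp.
- move=> _ _ [n [s ps ->]] [k [t pt ->]]; exists (n + k)%N, (s * t).
    by apply/negP => /pp.2; rewrite (negPf ps) (negPf pt).
  by rewrite exprD; ring.
apply: (prime_above_prime pq pp).
  move=> z qz; apply: contrapT => /negP pz; apply: (qS z qz).
  by exists 0%N, z; rewrite ?mulr1.
move=> /(_ x px)/qS; apply; exists 1%N, 1; rewrite ?mul1r //.
by case: pp.
Qed.

(** A prime containing [I] contains the regular element [x], hence [m]; so no [y] in [m] has all its
    powers outside [I]. Elements outside [m] are units, which makes [I] primary. *)
Lemma regular_m_primary (I : ideal R) (x : R) :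
  x \in I -> GRing.lreg x -> m_primary_or_unit m I.
Proof.
move=> Ix regx; have idI := carrier_ideal I.
have [I1|I1] := boolP (1 \in I).
  by right=> y; rewrite -[y]mulr1; apply: (idealM _ idI).
have radI y : radical I y -> y \in m.
  move=> [n Iyn]; apply: contrapT => /negP/(local_unit localR)[u yu].
  case/negP: I1; rewrite -(expr1n _ n) -yu exprMn.
  exact: (idealMr _ idI).
have mrad y : y \in m -> radical I y.
  move=> my; apply: contrapT => nrad.
  have [|||p [pp Ip py]] :=
      @prime_ideal_avoiding R (carrier I) (fun z => exists n, z = y ^+ n) idI.
  - by move=> z Iz [n e]; apply: nrad; exists n; rewrite -e.
  - by exists 0%N.
  - by move=> _ _ [n ->] [k ->]; exists (n + k)%N; rewrite exprD.
  apply: (py y); last by exists 1%N.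
  exact: (prime_above_regular pp (Ip x Ix) regx).
left; split; last by move=> y; split=> [/mrad|/radI].
split=> // u v Iuv; have [mv|mv] := boolP (v \in m); first by right; apply: mrad.
left; have [w vw] := local_unit localR mv; rewrite -[u]mulr1 -vw mulrA.
exact: (idealMr w idI Iuv).
Qed.

Lemma m_primary_regular (I : ideal R) : m_primary m I ->
  exists2 x, x \in I & GRing.lreg x.
Proof.
have [x mx regx] := arf_regular_element; move=> [_ rad].
by have /rad[n Ix] := mx; exists (x ^+ n) => //; apply: lregX.
Qed.

End LocalDimension.

(** * Powers and integral closures of ideals *)

Section IntegralEquation.
Variables (R K : comNzRingType) (f : {rmorphism R -> K}).

Lemma integral_equation n (c : 'I_n -> K) (y : K) : (0 < n)%N ->
  (forall i, integralOver f (c i)) ->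
  y ^+ n + \sum_(i < n) c i * y ^+ (n - i.+1) = 0 -> integralOver f y.
Proof.
move=> n0 intc e.
(* In the equation [c i] multiplies [y ^+ (n - i.+1)], so the coefficient of ['X^j] is [c] at the
   reversed index [n - j.+1]. *)
pose d (j : nat) : K := oapp c 0 (insub (n - j.+1)%N).
have intd j : integralOver f (d j).
  by rewrite /d; case: insubP => [i _ _|_] /=; [apply: intc | apply: integral0].
pose p : {poly K} := 'X^n + \poly_(j < n) d j.
have szr : (size (\poly_(j < n) d j) < size ('X^n : {poly K}))%N.
  by rewrite size_polyXn ltnS size_poly.
apply: (@integral_root_monic _ _ f y p).
- by rewrite monicE lead_coefDl // lead_coefXn.
- rewrite rootE hornerD hornerXn horner_poly -[X in _ == X]e.
  apply/eqP; congr (_ + _); rewrite (reindex_inj rev_ord_inj) /=.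
  apply: eq_bigr => i _; congr (_ * _); rewrite /d subnSK // subKn ?(ltnW
    (ltn_ord i)) //.
  by rewrite valK.
apply/integral_poly => j; rewrite coefD coefXn coef_poly.
apply: integral_add; first exact: integral_nat.
by case: ifP => _ //; apply: integral0.
Qed.

Lemma integralOver_equation (y : K) : integralOver f y ->
  exists n (c : 'I_n -> R), y ^+ n + \sum_(i < n) f (c i) * y ^+ i = 0.
Proof.
case=> p mp; rewrite rootE => /eqP; rewrite horner_coef size_map_poly_id0;
  last first.
  by rewrite (monicP mp) rmorph1 oner_neq0.
have := monic_neq0 mp; rewrite -size_poly_gt0 => /prednK sp.
have lead1 : (map_poly f p)`_(size p).-1 = 1.
  by rewrite coef_map [p`__](monicP mp); apply: rmorph1.
rewrite -sp big_ord_recr /= lead1 mul1r addrC => e;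
  exists (size p).-1, (fun i => p`_i).
by rewrite -[RHS]e; congr (_ + _); apply: eq_bigr => i _; rewrite coef_map.
Qed.

End IntegralEquation.

Section IdealPowers.
Variable R : comNzRingType.
Implicit Types A B C : set R.

Lemma ideal_mul_ind B C A : is_ideal A ->
  (forall b c, B b -> C c -> A (b * c)) -> (ideal_mul B C `<=` A)%classic.
Proof.
by move=> idA AM _ [n [b [c [Bc ->]]]]; apply: ideal_sum => // i _; apply: AM;
  case: (Bc i).
Qed.

Lemma ideal_mul_mem B C b c : B b -> C c -> ideal_mul B C (b * c).
Proof.
by move=> Bb Cc; exists 1%N, (fun=> b), (fun=> c); split=> //; rewrite big_ord1.
Qed.

Lemma ideal_mul_ideal B C : is_ideal C -> is_ideal (ideal_mul B C).
Proof.
move=> idC; split; first by exists 0%N, (fun=> 0), (fun=> 0); split=> [[]|] //;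
  rewrite big_ord0.
move=> a _ _ [n [b [c [Bc ->]]]] [k [b' [c' [Bc' ->]]]].
pose pick (u : 'I_n -> R) (v : 'I_k -> R) (i : 'I_(n + k)) :=
  match fintype.split i with inl i => u i | inr i => v i end.
exists (n + k)%N, (pick b b'), (pick (fun i => a * c i) c'); split.
  move=> i; rewrite /pick; case: (fintype.split i) => j; last exact: Bc'.
  by have [? ?] := Bc j; split=> //; apply: idealM.
rewrite big_split_ord mulr_sumr /pick; congr (_ + _); apply: eq_bigr => i _.
  by rewrite (unsplitK (inl i)); ring.
by rewrite (unsplitK (inr i)).
Qed.

Lemma ideal_pow_ideal B n : is_ideal (ideal_pow B n).
Proof. by elim: n => [|n IHn] //=; apply: ideal_mul_ideal. Qed.

Lemma ideal_powD B n k x y :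
  ideal_pow B n x -> ideal_pow B k y -> ideal_pow B (n + k) (x * y).
Proof.
elim: n x => [|n IHn] x; first by move=> _; apply: (idealM _ (ideal_pow_ideal B k)).
move=> /= Bx By; move: x Bx; apply: ideal_mul_ind => [|b c Bb Bc].
  have idB := ideal_pow_ideal B (n + k).+1.
  split=> [|a u v Bu Bv]; first by rewrite mul0r; apply: (ideal0 idB).
  by rewrite mulrDl -mulrA; apply: (idealD idB) => //; apply: (idealM _ idB).
by rewrite -mulrA; apply: ideal_mul_mem => //; apply: IHn.
Qed.

Lemma ideal_pow_mem B n x : B x -> ideal_pow B n (x ^+ n).
Proof.
by move=> Bx; elim: n => [|n IHn] //; rewrite exprS; apply: ideal_mul_mem.
Qed.

Lemma ideal_pow1 B : is_ideal B -> ideal_pow B 1 = B.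
Proof.
move=> idB; apply/seteqP; split=> [|x Bx].
  by apply: ideal_mul_ind => // b c Bb _; apply: idealMr.
by rewrite -[x]mulr1; apply: ideal_mul_mem.
Qed.

(** In a product of [n.+1] elements of [T], each multiplication trades one factor for [c], leaving a
    single element of [T]. *)
Lemma ideal_pow_absorb (T : set R) (c : R) n x : is_ideal T ->
  (forall y z, T y -> T z -> exists2 w, T w & y * z = c * w) ->
  ideal_pow T n.+1 x -> exists2 w, T w & x = c ^+ n * w.
Proof.
move=> idT absorb; elim: n x => [|n IHn] x.
  by rewrite ideal_pow1 // => Tx; exists x; rewrite ?mul1r.
move: x; apply: ideal_mul_ind => [|y z Ty /IHn[w Tw ->]].
  split=> [|a _ _ [u Tu ->] [v Tv ->]]; first by exists 0;
    [exact: ideal0|rewrite mulr0].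
  by exists (a * u + v); [apply: idealD => //; apply: idealM | ring].
have [v Tv e] := absorb _ _ Ty Tw; exists v => //.
by rewrite exprS mulrCA e; ring.
Qed.

Lemma ideal_pow_principal (a x : R) n :
  ideal_pow (principal a) n x -> exists r, x = a ^+ n * r.
Proof.
elim: n x => [|n IHn] x; first by exists x; rewrite mul1r.
move: x; apply: ideal_mul_ind => [|_ z [r ->] /IHn[s ->]].
  split=> [|b _ _ [u ->] [v ->]]; first by exists 0; rewrite mulr0.
  by exists (b * u + v); ring.
by exists (r * s); rewrite exprS; ring.
Qed.

End IdealPowers.

(** * The Rees algebra and the integral closure of an ideal *)

Section Rees.
Variables (R : comNzRingType) (B : set R).

(** The Rees algebra of [B] turns integral dependence on an ideal into integral dependence on a
    ring, where sums, products and transitivity are available. *)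
Definition rees_pred : {pred {poly R}} :=
  fun p => `[< forall i, ideal_pow B i p`_i >].

Lemma rees_closed : subring_closed rees_pred.
Proof.
split=> [|p q /asboolP Bp /asboolP Bq|p q /asboolP Bp /asboolP Bq];
    apply/asboolP => i; have idB := ideal_pow_ideal B i.
- by case: i idB => [|i] idB //; rewrite coefC; apply: ideal0 idB.
- by rewrite coefB; apply: idealB.
rewrite coefM; apply: ideal_sum => // j _.
by rewrite -[X in ideal_pow B X](subnKC (ltnSE (ltn_ord j))); apply: ideal_powD.
Qed.
HB.instance Definition _ :=
  GRing.isSubringClosed.Build {poly R} rees_pred rees_closed.

Record rees := MkRees { rees_val :> {poly R}; _ : rees_val \in rees_pred }.

HB.instance Definition _ := [isSub for rees_val].
HB.instance Definition _ := [Choice of rees by <:].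
HB.instance Definition _ := [SubChoice_isSubComNzRing of rees by <:].

Definition rees_int (q : {poly R}) := integralOver (val : rees -> {poly R}) q.

Lemma rees_int_mem (x : R) n : ideal_pow B n x -> rees_int (x%:P * 'X^n).
Proof.
move=> Bx; have Px : x%:P * 'X^n \in rees_pred.
  apply/asboolP => i; rewrite coefCM coefXn.
  case: eqP => [->|_]; rewrite ?mulr1 ?mulr0 //.
  exact: (ideal0 (ideal_pow_ideal B i)).
exact: (@integral_id _ _ (val : {rmorphism rees -> {poly R}}) (MkRees Px)).
Qed.

Lemma homogenized_equation n (a : 'I_n -> R) (x : R) :
  (x%:P * 'X) ^+ n +
    \sum_(i < n) ((a i)%:P * 'X^(i.+1)) * (x%:P * 'X) ^+ (n - i.+1) =
  (x ^+ n + \sum_(i < n) a i * x ^+ (n - i.+1))%:P * 'X^n.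
Proof.
rewrite rmorphD rmorph_sum mulrDl mulr_suml exprMn rmorphXn; congr (_ + _).
apply: eq_bigr => i _; rewrite exprMn rmorphM rmorphXn /=.
have -> : 'X^n = 'X^(i.+1) * 'X^(n - i.+1) :> {poly R} by rewrite -exprD subnKC.
by ring.
Qed.

(** An equation of degree [n] for [x], times ['X^n], is one for [x 'X] over the Rees algebra.
    Conversely, the coefficient of ['X^n.+1] in an equation of degree [n.+1] for [x 'X] takes from
    [c i] its coefficient of degree [n.+1 - i], which lies in that power of [B]. *)
Lemma int_closureP x : int_closure B x <-> rees_int (x%:P * 'X).
Proof.
split=> [[n [a [n0 Ba e]]]|].
  apply: (@integral_equation _ _ (val : {rmorphism rees -> {poly R}}) n
            (fun i => (a i)%:P * 'X^(i.+1))) => //.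
    by move=> i; apply: rees_int_mem.
  by rewrite homogenized_equation e mul0r.
case/integralOver_equation => n [c e].
case: n c e => [|n] c.
  by rewrite big_ord0 addr0 expr0 => /eqP; rewrite oner_eq0.
move=> /(congr1 (fun p : {poly R} => p`_n.+1)).
rewrite coefD coef0 coef_sum exprMn -rmorphXn coefCM coefXn eqxx mulr1.
rewrite (reindex_inj rev_ord_inj) /= => e.
exists n.+1, (fun i => (val (c (rev_ord i)))`_i.+1); split=> //.
  by move=> i; have /asboolP := valP (c (rev_ord i)); apply.
rewrite -[RHS]e; congr (_ + _); apply: eq_bigr => i _.
rewrite exprMn -rmorphXn mulrCA coefCM coefMXn mulrC; congr (_ * _).
have -> : (n.+1 - (n.+1 - i.+1) = i.+1)%N by rewrite subKn.
by rewrite ltnNge leq_subr.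
Qed.

End Rees.

Lemma int_closure_sub (R : comNzRingType) (B : set R) : is_ideal B ->
  (B `<=` int_closure B)%classic.
Proof.
move=> idB x Bx; exists 1%N, (fun=> - x); split=> // [i|].
  by rewrite (ord1 i) ideal_pow1 //; apply: idealN.
by rewrite big_ord1 expr1 subnn mulr1 subrr.
Qed.


Section IntClosure.
Variables (R : comNzRingType) (B : set R).

Lemma int_closure_ideal : is_ideal (int_closure B).
Proof.
split; first by apply/int_closureP; rewrite mul0r; apply: integral0.
move=> a x y /int_closureP intx /int_closureP inty; apply/int_closureP.
rewrite rmorphD rmorphM mulrDl -mulrA.
apply: integral_add => //; apply: integral_mul => //.
by have := @rees_int_mem R B a 0 I; rewrite mulr1.
Qed.

Lemma int_closure_pow n x :
  ideal_pow (int_closure B) n x -> rees_int B (x%:P * 'X^n).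
Proof.
elim: n x => [|n IHn] x; first by move=> _; apply: rees_int_mem.
move=> [k [b [c [Bc ->]]]]; rewrite rmorph_sum mulr_suml.
elim/big_ind: _ => [|u v|i _]; [exact: integral0|exact: integral_add|].
have [/int_closureP intb /IHn intc] := Bc i.
rewrite rmorphM exprS (_ : _ * _ = (b i)%:P * 'X * ((c i)%:P * 'X^n));
  last by rewrite /=; ring.
exact: integral_mul.
Qed.

(** Homogenizing an equation over the closure gives coefficients integral over the Rees algebra, so
    transitivity of integrality applies. *)
Lemma int_closure_idem : int_closure (int_closure B) = int_closure B.
Proof.
apply/seteqP; split=> x; last exact: (int_closure_sub int_closure_ideal).
case=> n [a [n0 Ba e]]; apply/int_closureP.
apply: (@integral_equation _ _ (val : {rmorphism rees B -> {poly R}}) n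
          (fun i => (a i)%:P * 'X^(i.+1))) => //.
  by move=> i; apply: int_closure_pow.
by rewrite homogenized_equation e mul0r.
Qed.

End IntClosure.

(** * Integrally closed ideals of an Arf ring *)

Section Fractions.
Variable R : comNzRingType.
Implicit Types (d : denom (nzd R)) (x y : R).

Lemma regular_denom x : GRing.lreg x -> exists d, sval d = x.
Proof. by move=> /asboolP rx; exists (exist _ x rx). Qed.

Lemma to_frac_inj : injective (@to_frac R).
Proof.
by move=> x y /locfrac_eq[u /asboolP ru]; rewrite /= !scale1r => /ru.
Qed.

Lemma qfracK x d : to_frac (sval d) * qfrac x d = to_frac x.
Proof.
rewrite [LHS]loc_scaleE; apply: loc_eq.
by rewrite /= scale1r mul1r.
Qed.

Lemma denom_frac_regular d : GRing.lreg (to_frac (sval d)).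
Proof.
have e : qfrac 1 d * to_frac (sval d) = 1 by rewrite mulrC qfracK rmorph1.
by move=> p q epq; rewrite -[p]mul1r -[q]mul1r -e -!mulrA epq.
Qed.

(** Dividing an equation of [x] over the principal ideal by [d ^+ n] gives an integral equation of
    [x / d], and conversely. This links closures of ideals to [int_pred], in terms of which
    [arf_quotient] is stated. *)
Lemma int_closure_principalP x d :
  int_closure (principal (sval d)) x <-> qfrac x d \in @int_pred R.
Proof.
split.
  move=> [n [a [n0 aP e]]]; apply/asboolP.
  have /choice[r ar] i : exists r, a i = sval d ^+ i.+1 * r.
    exact: (ideal_pow_principal (aP i)).
  apply: (@integral_equation _ _ (@to_frac R) n (fun i => to_frac (r i))) => //.
    by move=> i; apply: integral_id.
  apply: (lregX (n := n) (@denom_frac_regular d));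
    rewrite mulr0 mulrDr -exprMn qfracK.
  rewrite -[RHS](rmorph0 (@to_frac R)) -e rmorphD rmorphXn; congr (_ + _).
  rewrite rmorph_sum mulr_sumr; apply: eq_bigr => i _.
  rewrite ar !rmorphM !rmorphXn /= -[in RHS](qfracK x d) exprMn.
  have -> : to_frac (sval d) ^+ n =
      to_frac (sval d) ^+ i.+1 * to_frac (sval d) ^+ (n - i.+1).
    by rewrite -exprD subnKC.
  by ring.
move/asboolP/integralOver_equation => [n [c e]].
case: n c e => [|n] c.
  by rewrite big_ord0 addr0 expr0 => /eqP; rewrite oner_eq0.
rewrite (reindex_inj rev_ord_inj) /= => e.
exists n.+1, (fun i : 'I_n.+1 => sval d ^+ i.+1 * c (rev_ord i)); split=> //.
  move=> i; apply: (idealMr _ (ideal_pow_ideal _ _)); apply: ideal_pow_mem.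
  by exists 1; rewrite mulr1.
apply: to_frac_inj; rewrite rmorph0 -[RHS](mulr0 (to_frac (sval d) ^+ n.+1)) -e.
rewrite rmorphD rmorphXn mulrDr /= -(qfracK x d) exprMn; congr (_ + _).
rewrite rmorph_sum mulr_sumr; apply: eq_bigr => i _.
rewrite !rmorphM !rmorphXn /= -(qfracK x d) exprMn.
have -> : to_frac (sval d) ^+ n.+1 =
    to_frac (sval d) ^+ i.+1 * to_frac (sval d) ^+ (n.+1 - i.+1).
  by rewrite -exprD subnKC.
by ring.
Qed.

Lemma int_pred_mul (p q : total_frac R) :
  p \in @int_pred R -> q \in @int_pred R -> p * q \in @int_pred R.
Proof. by have [_ _] := @int_pred_closed R; apply. Qed.

End Fractions.

(* When [t] is regular in [T], this says that [t^-1 T] is a ring. *)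
Definition stable (R : comNzRingType) (T : set R) (t : R) :=
  forall y z, T y -> T z -> exists2 w, T w & y * z = t * w.

Definition has_regular (R : comNzRingType) (T : set R) :=
  exists2 x, T x & GRing.lreg x.

(** A total division by [a], with default [0] off the multiples of [a], so that maps such as
    multiplication by [y / a] become functions on [R]. *)
Lemma divisor_quotient (R : comNzRingType) (a : R) : exists q : R -> R,
  forall u, (exists w, u = a * w) -> a * q u = u.
Proof.
exists (fun u => xget 0 [set w | u = a * w]%classic) => u [w e].
by case: xgetP => [_ _ -> //|/(_ w)].
Qed.

(** * Reductions and stability in an Arf ring *)

Section ArfIdeals.
Variables (R : comNzRingType) (arfR : arf_ring R).
Implicit Types T : set R.

(** [arf_quotient] provides [r] with [y * z = a * r], and [r / a] is the product of the integral
    fractions [y / a] and [z / a]. *)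
Lemma int_closure_principal_mul (a y z : R) : GRing.lreg a ->
  int_closure (principal a) y -> int_closure (principal a) z ->
  exists2 w, int_closure (principal a) w & y * z = a * w.
Proof.
move=> /regular_denom[d <-] /int_closure_principalP Iy /int_closure_principalP Iz.
have [r e] := arf_quotient arfR Iy Iz.
have er : y * z = sval d * r.
  by apply: to_frac_inj; rewrite -(qfracK _ d) e rmorphM.
exists r => //; apply/int_closure_principalP.
have -> : qfrac r d = qfrac y d * qfrac z d.
  apply: (@denom_frac_regular _ d); rewrite qfracK mulrA qfracK.
  apply: (@denom_frac_regular _ d); rewrite mulrCA qfracK -rmorphM -er.
  by rewrite rmorphM.
exact: int_pred_mul Iy Iz.
Qed.

Lemma int_closed_stable T : is_ideal T -> int_closure T = T -> has_regular T ->
  exists a, [/\ T a, GRing.lreg a, T = int_closure (principal a) & stable T a].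
Proof.
move=> idT clT [x Tx regx].
have [||a /(mk_idealP idT) Ta] := @arf_reduction R arfR (mk_ideal idT).
- by rewrite /integrally_closed carrier_mk_ideal clT.
- by exists x => //; apply/(mk_idealP idT).
rewrite carrier_mk_ideal => eT; exists a.
(* An integral equation of the regular element [x] over [(a)] makes [x ^+ n] a multiple of [a], and
   a divisor of a regular element is regular. *)
have rega : GRing.lreg a.
  move: Tx; rewrite eT => -[n [c [n0 aP e]]].
  have [s es] : exists s, x ^+ n = a * s.
    have idp := principal_ideal a.
    suff : principal a (x ^+ n) by [].
    rewrite -[x ^+ n]subr0 -e opprD addrA subrr add0r.
    apply: (idealN idp); apply: ideal_sum => // i _.
    apply: (idealMr _ idp); have [r ->] := ideal_pow_principal (aP i).
    by exists (a ^+ i * r); rewrite exprS mulrA.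
  by move=> u v euv; apply: (lregX (n := n) regx);
    rewrite es mulrAC [a * u]euv mulrAC.
split=> //.
by rewrite eT => y z; apply: int_closure_principal_mul.
Qed.

(* With [y] in the closure [cl T = cl (c)], multiplication by [y / c] maps [T]
   into [R], hence into [T]; dividing an integral equation of [c] over [T] by a
   power of [c] then shows that [c] is in [T]. *)
Lemma trace_closed_int_closed T : is_ideal T -> has_regular T ->
  (forall g : R -> R, (forall a x y, T x -> T y -> g (a * x + y) = a * g x + g y) ->
     forall x, T x -> T (g x)) ->
  int_closure T = T.
Proof.
move=> idT [x Tx regx] trT; have idC := int_closure_ideal T.
have subC := int_closure_sub idT.
have [||c [Cc regc _ stC]] := int_closed_stable idC; first exact: int_closure_idem.
  by exists x => //; apply: subC.
have absorb y z : int_closure T y -> T z -> exists2 w, T w & y * z = c * w.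
  move=> Cy; have [q' q'E] := divisor_quotient c; pose q u := q' (y * u).
  have qE u : T u -> c * q u = y * u.
    by move=> Tu; apply: q'E; have [w _ e] := stC _ _ Cy (subC _ Tu); exists w.
  move=> Tz; exists (q z); last by rewrite qE.
  apply: trT => // a u v Tu Tv; apply: regc.
  rewrite mulrDr mulrCA !qE //; first by ring.
  by apply: idealD => //; apply: idealM.
have Tc : T c.
  have [n [a [n0 aP e]]] := Cc.
  have /choice[b bP] i : exists w, T w /\ a i = c ^+ i * w.
    have [y z /subC Cy Tz|w Tw ->] := ideal_pow_absorb (c := c) idT _ (aP i).
      exact: absorb.
    by exists w.
  (* As [a i = c ^+ i * b i], each lower term of the equation is [c ^+ n.-1 * b i], and [c ^+ n.-1]
     cancels. *)
  have -> : c = - \sum_(i < n) b i.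
    apply: (lregX (n := n.-1) regc); rewrite -exprSr prednK // mulrN.
    apply/eqP; rewrite -addr_eq0 -[X in _ == X]e mulr_sumr; apply/eqP.
    congr (_ + _); apply: eq_bigr => i _; rewrite (bP i).2 mulrAC -exprD.
    by congr (_ ^+ _ * _); apply/eqP; rewrite -eqSS prednK // -addSn subnKC.
  by apply: (idealN idT); apply: ideal_sum => // i _; case: (bP i).
apply/seteqP; split=> // y Cy; have [w Tw] := absorb _ _ Cy Tc.
by rewrite mulrC => /regc->.
Qed.

End ArfIdeals.

(** * Duals, reflexive modules and trace ideals *)

Section ModuleIso.
Variable R : comNzRingType.
Implicit Types M N : lmodType R.

Lemma linear_intro M N (f : M -> N) : linear f -> exists g : {linear M ->
  N}, g =1 f.
Proof.
move=> lf; pose F := GRing.isLinear.Build R M N *:%R f lf.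
by exists (HB.pack_for {linear M -> N} f F).
Qed.

Lemma module_iso_intro M N (f : M -> N) : linear f -> bijective f -> module_iso M N.
Proof.
by move=> /linear_intro[g gf] bf; exists g; apply: (eq_bij bf) => x; rewrite gf.
Qed.

Lemma module_iso_inverse M N : module_iso M N ->
  exists (f : {linear M -> N}) (g : {linear N -> M}), cancel f g /\ cancel g f.
Proof.
case=> f [g fK gK]; have [|h hg] := @linear_intro _ _ g.
  by move=> a x y; apply: (can_inj fK); rewrite linearP !gK.
by exists f, h; split=> x; rewrite hg.
Qed.

Lemma module_iso_sym M N : module_iso M N -> module_iso N M.
Proof. by case/module_iso_inverse=> f [g [fK gK]]; exists g, f. Qed.

Lemma module_iso_trans M N P : module_iso M N -> module_iso N P -> module_iso M P.
Proof.
case=> f bf [g bg]; apply: (@module_iso_intro _ _ (g \o f)); last exact: bij_comp.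
by move=> a x y; rewrite /= !linearP.
Qed.

Lemma submodZ (I : ideal R) (a : R) (x : submod I) : val (a *: x) = a * val x :> R.
Proof. by []. Qed.

Lemma submodD (I : ideal R) (x y : submod I) : val (x + y) = val x + val y :> R.
Proof. by []. Qed.

Lemma iso_has_regular (I J : ideal R) :
  module_iso (submod I) (submod J) -> has_regular (carrier I) ->
    has_regular (carrier J).
Proof.
case=> f [g fK _] [x Ix regx]; pose x' : submod I := Submod Ix.
exists (val (f x')); first exact: valP.
move=> r s e; apply: regx.
have /(can_inj fK)/(congr1 val) e' : f (r *: x') = f (s *: x').
  by rewrite !linearZ; apply: val_inj; rewrite !submodZ mulrC e mulrC.
by rewrite !submodZ in e'; rewrite mulrC e' mulrC.
Qed.

(* The isomorphism is multiplication by the fraction [c / a]. *)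
Lemma ratio_iso (I J : ideal R) (a c : R) : GRing.lreg a -> GRing.lreg c ->
  (forall y, y \in I -> exists2 w, w \in J & c * y = a * w) ->
  (forall z, z \in J -> exists2 y, y \in I & a * z = c * y) ->
  module_iso (submod I) (submod J).
Proof.
move=> rega regc IJ JI.
have /choice[f fP] (y : submod I) : exists w : submod J, c * val y = a * val w.
  by have [w Jw e] := IJ _ (valP y); exists (Submod Jw).
have /choice[g gP] (z : submod J) : exists y : submod I, a * val z = c * val y.
  by have [w Jw e] := JI _ (valP z); exists (Submod Jw).
apply: (@module_iso_intro _ _ f); last first.
  exists g => z; apply: val_inj.
    by apply: regc; rewrite -gP fP.
  by apply: rega; rewrite -fP gP.
move=> k x y; apply/val_inj/rega; rewrite -fP.
by rewrite !submodD !submodZ !mulrDr ![_ * (k * _)]mulrCA !fP.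
Qed.

End ModuleIso.

Section Duals.
Variables (R : comNzRingType) (M : lmodType R).
Implicit Types (f g : dual M) (x y : M).

Lemma dual_linear f a x y : dual_app f (a *: x + y) = a * dual_app f x +
  dual_app f y.
Proof. by have /asboolP lf := valP f; apply: lf. Qed.

Lemma dual0 f : dual_app f 0 = 0.
Proof.
have := dual_linear f (-1) 0 0; rewrite scaler0 addr0 mulN1r addNr; exact.
Qed.

Lemma dualZ f a x : dual_app f (a *: x) = a * dual_app f x.
Proof. by rewrite -[a *: x]addr0 dual_linear dual0 addr0. Qed.

Lemma dualD f x y : dual_app f (x + y) = dual_app f x + dual_app f y.
Proof. by rewrite -[x]scale1r dual_linear mul1r scale1r. Qed.

Lemma dual_scale f a x : dual_app (a *: f) x = a * dual_app f x.
Proof. by []. Qed.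

Lemma dual_ext f g : dual_app f =1 dual_app g -> f = g.
Proof. by move=> fg; apply/val_inj/funext. Qed.

Section MkDual.
Variables (h : M -> R) (hlin : forall a x y, h (a *: x + y) = a * h x + h y).

Lemma mk_dual_subproof : (h : M -> R^o) \in @dual_pred R M.
Proof. by apply/asboolP. Qed.

Definition mk_dual : dual M := Submod mk_dual_subproof.

Lemma mk_dualE x : dual_app mk_dual x = h x. Proof. by []. Qed.

End MkDual.

Lemma trace_mem f x : trace M (dual_app f x).
Proof. by exists 1%N, (fun=> f), (fun=> x); rewrite big_ord1. Qed.

Lemma trace_is_ideal : is_ideal (trace M).
Proof.
split; first by exists 0%N, (fun=> 0), (fun=> 0); rewrite big_ord0.
move=> a _ _ [n [f [x ->]]] [k [g [y ->]]].
pose pick T (u : 'I_n -> T) (v : 'I_k -> T) (i : 'I_(n + k)) :=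
  match fintype.split i with inl i => u i | inr i => v i end.
exists (n + k)%N, (pick _ f g), (pick _ (fun i => a *: x i) y).
rewrite big_split_ord mulr_sumr /pick; congr (_ + _); apply: eq_bigr => i _.
  by rewrite (unsplitK (inl i)) dualZ.
by rewrite (unsplitK (inr i)).
Qed.

Lemma trace_ind (A : set R) : is_ideal A -> (forall f x, A (dual_app f x)) ->
  (trace M `<=` A)%classic.
Proof. by move=> idA Af _ [n [f [x ->]]]; apply: ideal_sum. Qed.

(** The composite of [g] with a form on [M] is again a form on [M]. *)
Lemma trace_closed (g : R -> R) :
  (forall a u v : R, trace M u -> trace M v -> g (a * u + v) = a * g u + g v) ->
  forall x : R, trace M x -> trace M (g x).
Proof.
move=> glin x Tx; have idT := trace_is_ideal.
have g0 : g 0 = 0.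
  by have := glin (-1) 0 0 (ideal0 idT) (ideal0 idT);
    rewrite mulr0 addr0 mulN1r addNr.
(* Membership in the trace is carried along because [g] is linear only there. *)
suff: (trace M `<=` [set x | trace M x /\ trace M (g x)])%classic by case/(_ x Tx).
apply: trace_ind => [|f y].
  split=> [|a u v [Tu Tgu] [Tv Tgv]]; first by split; rewrite ?g0; apply: ideal0.
  by split; rewrite ?glin //; apply: (idealD idT) => //; apply: idealM.
split; first exact: trace_mem.
have gflin a u v : g (dual_app f (a *: u + v)) = a * g (dual_app f u) + g
  (dual_app f v).
  by rewrite dual_linear glin //; apply: trace_mem.
exact: (trace_mem (mk_dual gflin)).
Qed.

(** Forms separate points, and functionals on the dual are evaluations; plain functions spare later
    arguments the construction of elements of the bidual. *)
Lemma reflexiveP : reflexive_module M <->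
  (forall x, (forall f, dual_app f x = 0) -> x = 0) /\
  (forall phi : dual M -> R,
     (forall a f g, phi (a *: f + g) = a * phi f + phi g) ->
     exists x, forall f, phi f = dual_app f x).
Proof.
split=> [[r rK Kr]|[inj surj]].
  split=> [x x0|phi philin].
    apply: (can_inj rK); apply/val_inj/funext => f /=.
    by rewrite -[LHS]/(dual_app f x) x0 -[RHS]/(dual_app f 0) dual0.
  have phiP : (phi : dual M -> R^o) \in @dual_pred R (dual M) by apply/asboolP.
  exists (r (Submod phiP)) => f.
  by have /(congr1 val)/(congr1 (@^~ f)) := Kr (Submod phiP).
have /choice[r rP] (p : dual (dual M)) : exists x, p = to_bidual x.
  case: p => p pP; have [|x e] := surj p; first by move/asboolP: (pP).
  by exists x; apply/val_inj/funext.
exists r => // x; apply/eqP; rewrite -subr_eq0; apply/eqP/inj => f.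
have /(congr1 val)/(congr1 (@^~ f)) := rP (to_bidual x).
rewrite -scaleN1r addrC dual_linear mulN1r /= => e.
by rewrite -[X in _ + X]e addNr.
Qed.

End Duals.

Section TransportReflexive.
Variables (R : comNzRingType) (M N : lmodType R).

(** A functional on the dual of [N] is pulled back along restriction by [i]; if [x] in [M]
    represents the result, [p x] represents the original. *)
Lemma reflexive_retract (i : {linear N -> M}) (p : {linear M -> N}) :
  cancel i p -> reflexive_module M -> reflexive_module N.
Proof.
move=> iK /reflexiveP[inj surj]; apply/reflexiveP; split=> [x x0|phi philin].
  rewrite -[x]iK (inj (i x)) ?linear0 // => f.
  have flin a u v : dual_app f (i (a *: u + v)) = a * dual_app f (i u) +
    dual_app f (i v).
    by rewrite linearP dual_linear.
  by rewrite -(mk_dualE flin) x0.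
have ilin (f : dual M) a u v :
    dual_app f (i (a *: u + v)) = a * dual_app f (i u) + dual_app f (i v).
  by rewrite linearP dual_linear.
have plin (f : dual N) a u v :
    dual_app f (p (a *: u + v)) = a * dual_app f (p u) + dual_app f (p v).
  by rewrite linearP dual_linear.
have [|x xP] := surj (fun f => phi (mk_dual (ilin f))).
  by move=> a f g; rewrite -philin; congr phi; apply: dual_ext.
exists (p x) => f; rewrite -[RHS](mk_dualE (plin f)) -xP.
by congr phi; apply: dual_ext => y; rewrite !mk_dualE iK.
Qed.

Lemma reflexive_iso : module_iso M N -> reflexive_module M -> reflexive_module N.
Proof. by case/module_iso_inverse=> f [g [fK gK]]; apply: reflexive_retract gK. Qed.

End TransportReflexive.

(** * Integrally closed ideals and their trace ideals *)

Section ArfTrace.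
Variables (R : comNzRingType) (arfR : arf_ring R).

Lemma trace_int_closed (M : lmodType R) : has_regular (trace M) ->
  int_closure (trace M) = trace M.
Proof.
move=> reg; apply: trace_closed_int_closed => //; first exact: trace_is_ideal.
exact: trace_closed.
Qed.

Variables (J : ideal R) (intJ : int_closure (carrier J) = carrier J).
Hypothesis regJ : has_regular (carrier J).

Let incl_linear (a : R) (x y : submod J) :
  val (a *: x + y) = a * val x + val y :> R.
Proof. by []. Qed.

Let incl : dual (submod J) := mk_dual incl_linear.

Lemma sub_trace : (carrier J `<=` trace (submod J))%classic.
Proof. by move=> x Jx; have := trace_mem incl (Submod Jx). Qed.

Let C := trace (submod J).

(* [c] and [a] are reductions of the trace ideal [C] of [J] and of [J]; the
   isomorphism from [J] onto [C] is multiplication by [c / a]. *)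
Lemma trace_reductions : exists a c : R,
  [/\ a \in J, GRing.lreg a, C c & GRing.lreg c] /\
  [/\ (forall z y : R, C z -> y \in J -> exists2 w, C w & z * y = a * w),
      (forall z y : R, C z -> a * z = c * y -> y \in J)
    & (forall z : R, C z -> exists2 w, C w & a * z = c * w)].
Proof.
have idJ := carrier_ideal J; have idC := trace_is_ideal (submod J).
have [a [Ja rega eJ stJ]] := int_closed_stable arfR idJ intJ regJ.
have regC : has_regular C by case: regJ => x /sub_trace; exists x.
have [c [Cc regc eC stC]] := int_closed_stable arfR idC (trace_int_closed regC)
  regC.
exists a, c; split=> //; split.
- move=> z y Cz; move: z Cz y; apply: trace_ind => [|f x y Jy].
    split=> [y _|k u v Cu Cv y Jy]; first by exists 0;
      rewrite ?mul0r ?mulr0 //; apply: ideal0 idC.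
    have [w Cw ew] := Cu y Jy; have [w' Cw' ew'] := Cv y Jy.
    exists (k * w + w'); first by apply: (idealD idC) => //; apply: idealM.
    by rewrite mulrDl -mulrA ew ew'; ring.
  have [w Jw e] := stJ _ _ (valP x) Jy.
  exists (dual_app f (Submod Jw)); first exact: trace_mem.
  rewrite mulrC -!dualZ; congr dual_app; apply: val_inj.
  by rewrite /= -[LHS]/(y * val x) mulrC e.
- move=> z y Cz e; have [da eda] := regular_denom rega.
  have [dc edc] := regular_denom regc.
  suff : carrier J y by [].
  rewrite eJ -eda; apply/int_closure_principalP.
  (* The fraction [z / c] is integral since [C] is the closure of [(c)]; being equal to [y / a], it
     puts [y] in [J], the closure of [(a)]. *)
  have -> : qfrac y da = qfrac z dc.
    apply: (@denom_frac_regular _ da); apply: (@denom_frac_regular _ dc).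
    by rewrite qfracK mulrCA qfracK -!rmorphM eda edc -e.
  by apply/int_closure_principalP; rewrite edc -eC.
- by move=> z Cz; apply: stC => //; apply: sub_trace.
Qed.

Lemma int_closed_iso_trace :
  module_iso (submod J) (submod (mk_ideal (trace_is_ideal (submod J)))).
Proof.
have [a [c [[Ja rega Cc regc] [divC inJ stC]]]] := trace_reductions.
apply: (ratio_iso rega regc) => [y Jy|z /(mk_idealP (trace_is_ideal _)) Cz].
  have [w Cw e] := divC c y Cc Jy; exists w => //.
  exact/(mk_idealP (trace_is_ideal _)).
by have [w Cw e] := stC z Cz; exists w => //; apply: inJ e.
Qed.

(** A functional [phi] on the dual is evaluation at [phi incl]; the point is that this element of
    [R] lies in [J]. *)
Lemma int_closed_reflexive : reflexive_module (submod J).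
Proof.
have [a [c [[Ja rega Cc regc] [divC inJ stC]]]] := trace_reductions.
have [q qP] := divisor_quotient a; pose a' : submod J := Submod Ja.
apply/reflexiveP; split=> [x x0|phi philin].
  by apply: val_inj; have := x0 incl.
(* As forms, [a f = f(a) incl], because [a f(x) = f(a x) = x f(a)]; then [phi] is applied. *)
have phiE f : a * phi f = dual_app f a' * phi incl.
  have phi0 : phi 0 = 0.
    by have := philin (-1) 0 0; rewrite scaler0 addr0 mulN1r addNr.
  have phiZ k g : phi (k *: g) = k * phi g.
    by rewrite -[k *: g]addr0 philin phi0 addr0.
  rewrite -!phiZ; congr phi; apply: dual_ext => x.
  rewrite !dual_scale mk_dualE -dualZ [RHS]mulrC -dualZ.
  by congr dual_app; apply: val_inj; rewrite !submodZ mulrC.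
(* For [z] in [C] the form [z incl / a] sends [a] to [z], so that [phiE] makes [z * phi incl] a
   multiple of [a]. *)
have CphiE z : C z -> a * q (z * phi incl) = z * phi incl.
  move=> Cz; apply: (qP (z * phi incl)).
  have divz (x : submod J) : a * q (z * val x) = z * val x.
    by apply: qP; have [w _ e] := divC z (val x) Cz (valP x); exists w.
  have zlin (k : R) (x y : submod J) :
      q (z * val (k *: x + y)) = k * q (z * val x) + q (z * val y).
    by apply: rega; rewrite [RHS]mulrDr [a * (k * _)]mulrCA !divz incl_linear; ring.
  exists (phi (mk_dual zlin)); rewrite phiE; congr (_ * _).
  by apply: rega; rewrite mk_dualE divz /= mulrC.
(* Multiplication by [phi incl / a] maps [C] linearly into [R], hence into the trace ideal [C]; its
   value at [c] puts [phi incl] in [J] by [inJ]. *)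
have Jphi : phi incl \in J.
  apply: (inJ (q (c * phi incl))); last exact: CphiE.
  apply: (trace_closed (g := fun z => q (z * phi incl)) _ Cc) => k x y Cx Cy;
    have idC := trace_is_ideal (submod J).
  apply: rega; rewrite mulrDr [a * (k * _)]mulrCA !CphiE //; first by ring.
  by apply: (idealD idC) => //; apply: idealM.
exists (Submod Jphi) => f; apply: rega; rewrite phiE mulrC -[LHS]dualZ -[RHS]dualZ.
by congr dual_app; apply: val_inj; rewrite !submodZ mulrC.
Qed.

End ArfTrace.

(** * The semilocal ring attached to a stable ideal *)

(** Linear dependence of [k > n] vectors of length [n] over the residue field, expressed in [R]
    itself. *)
Lemma local_relation (R : comNzRingType) (m : ideal R) : local_at m ->
  forall n k (A : 'I_k -> 'I_n -> R), (n < k)%N ->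
  exists r : 'I_k -> R, (exists j, r j \notin m) /\
    forall i, \sum_j r j * A j i \in m.
Proof.
move=> localR; have idm := carrier_ideal m; elim=> [|n IHn] k A nk.
  exists (fun=> 1); split; last by case.
  by exists (Ordinal nk); case: localR.1.
have [Am|] := pselect (forall j, A j ord0 \in m).
  have [r [rm rA]] := IHn k (fun j i => A j (lift ord0 i)) (ltnW nk).
  exists r; split=> // i; case: (unliftP ord0 i) => [i' ->|->]; first exact: rA.
  by apply: (ideal_sum (A := carrier m)) => // j _; apply: (idealM _ idm);
    apply: Am.
move=> /existsNP[j0 /negP/(local_unit localR)[u Au]].
case: k A nk j0 Au => [//|k] A nk j0 Au.
(* Gaussian elimination with the unit [A j0 ord0] as pivot: multiples of row [j0] are subtracted to
   clear column [ord0] of the other rows. The coefficient [s] of row [j0] collects these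
   multiples. *)
pose A' (j : 'I_k) (i : 'I_n) :=
  A (lift j0 j) (lift ord0 i) - A (lift j0 j) ord0 * u * A j0 (lift ord0 i).
have [r [[j1 rj1] rA]] := IHn k A' nk.
pose s := - \sum_j r j * (A (lift j0 j) ord0 * u).
pose r' j := if unlift j0 j is Some j' then r j' else s.
exists r'; split; first by exists (lift j0 j1); rewrite /r' liftK.
move=> i; rewrite (bigD1_ord j0) //= /r' unlift_none.
under eq_bigr do rewrite liftK.
case: (unliftP ord0 i) => [i' ->|->].
  suff <- : \sum_j r j * A' j i' =
      s * A j0 (lift ord0 i') + \sum_j r j * A (lift j0 j) (lift ord0 i') by [].
  rewrite /s mulNr mulr_suml -sumrN -big_split; apply: eq_bigr => j _ /=.
  by rewrite /A'; ring.
suff -> : s * A j0 ord0 + \sum_j r j * A (lift j0 j) ord0 = 0 by exact: (ideal0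
  idm).
rewrite /s mulNr mulr_suml -sumrN -big_split; apply: big1 => j _ /=.
by rewrite -!mulrA [u * _]mulrC Au mulr1 addNr.
Qed.

Lemma prime_prod (R : comNzRingType) (p : ideal R) (I : finType) (P : pred I)
  (x : I -> R) :
  prime_ideal p -> (forall i, P i -> x i \notin p) -> \prod_(i | P i) x i \notin p.
Proof.
move=> [p1 pM] px; elim/big_ind: _ => // u v pu pv; apply/negP => /pM.
by rewrite (negPf pu) (negPf pv).
Qed.

Section StableRing.
Variables (R : comNzRingType) (T : ideal R) (t : R).
Hypothesis redT : [/\ t \in T, GRing.lreg t & stable (carrier T) t].

(* The ring [t^-1 T], with [b] in [T] standing for the fraction [b / t]; the
   argument [redT], unused in the carrier, determines the multiplication. *)
Definition sring := (fun _ : [/\ t \in T, GRing.lreg t & stable (carrier T) t]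
  => submod T) redT.
HB.instance Definition _ := GRing.Lmodule.on sring.

Implicit Types a b c : sring.
Let v (b : sring) : R := submod_val b.

Let regt : GRing.lreg t. Proof. by case: redT. Qed.

Lemma sring_inj b c : v b = v c -> b = c.
Proof. by move=> e; apply: val_inj. Qed.

Lemma sring_mul_subproof b c : exists d : sring, v b * v c = t * v d.
Proof.
case: redT => _ _ stT; have [w Tw e] := stT _ _ (valP (b : submod T)) (valP (c
  : submod T)).
by exists (Submod Tw : submod T).
Qed.

Definition smul b c : sring := sval (cid (sring_mul_subproof b c)).
Definition sone : sring := let: And3 Tt _ _ := redT in (Submod Tt : submod T).

Lemma smulE b c : t * v (smul b c) = v b * v c.
Proof. by rewrite /smul; case: cid. Qed.

Lemma soneE : v sone = t. Proof. by rewrite /sone; case: redT. Qed.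

Lemma sring_eq b c : t * v b = t * v c -> b = c.
Proof. by move=> /regt/sring_inj. Qed.

Lemma smulA : associative smul.
Proof.
move=> a b c; apply/sring_eq; rewrite !smulE; apply: regt.
by rewrite mulrCA smulE [in RHS]mulrA smulE mulrA.
Qed.

Lemma smulC : commutative smul.
Proof. by move=> b c; apply/sring_eq; rewrite !smulE mulrC. Qed.

Lemma smul1 : left_id sone smul.
Proof. by move=> b; apply/sring_eq; rewrite smulE soneE. Qed.

Lemma sringD b c : v (b + c) = v b + v c. Proof. by []. Qed.

Lemma smulDl : left_distributive smul +%R.
Proof.
by move=> a b c; apply/sring_eq; rewrite smulE !sringD mulrDr !smulE mulrDl.
Qed.

Lemma sone_neq0 : sone != 0.
Proof.
apply/eqP => /(congr1 v); rewrite soneE => t0.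
have /regt/eqP : t * 1 = t * 0 by rewrite t0 mul0r mul0r.
by rewrite oner_eq0.
Qed.

HB.instance Definition _ := GRing.Zmodule_isComNzRing.Build sring
  smulA smulC smul1 smulDl sone_neq0.

End StableRing.

(** * Maximal ideals of the ring [t^-1 T], and forms attaining [t] *)

Section Semilocal.
Variables (R : comNzRingType) (m : ideal R) (localR : local_at m).
Variables (T : ideal R) (t : R).
Hypothesis redT : [/\ t \in T, GRing.lreg t & stable (carrier T) t].
Hypothesis closT : carrier T = int_closure (principal t).

Let B : comNzRingType := sring redT.
(** Inside the total ring of fractions [v b] is [t] times [b], whence [v 1 = t]; the map [rho] below
    is the inclusion of [R] in [B]. *)
Let v (b : B) : R := submod_val (b : submod T).
Let regt : GRing.lreg t. Proof. by case: redT. Qed.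

Let vM (b c : B) : t * v (b * c) = v b * v c. Proof. exact: smulE. Qed.
Let vD (b c : B) : v (b + c) = v b + v c. Proof. by []. Qed.
Let v1 : v 1 = t. Proof. exact: soneE. Qed.
Let v_inj (b c : B) : v b = v c -> b = c. Proof. exact: sring_inj. Qed.

Let rho (r : R) : B := (r *: (1 : sring redT) : sring redT).

Let v_rho r (b : B) : v (rho r * b) = r * v b.
Proof.
by apply: regt; rewrite vM -[v (rho r)]/(r * v 1) v1; ring.
Qed.

Let rho1 : rho 1 = 1. Proof. exact: scale1r. Qed.
Let rhoD r s : rho (r + s) = rho r + rho s. Proof. exact: scalerDl. Qed.
Let rhoM r s : rho (r * s) = rho r * rho s.
Proof. by apply: v_inj; rewrite v_rho -[v (rho s)]/(s * v 1) mulrA. Qed.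
Let rho0 : rho 0 = 0. Proof. exact: scale0r. Qed.
Let rhoX r n : rho (r ^+ n) = rho r ^+ n.
Proof. by elim: n => [|n IHn] //; rewrite !exprS rhoM IHn. Qed.
Let rho_sum (I : finType) (f : I -> R) : rho (\sum_i f i) = \sum_i rho (f i).
Proof. exact: (big_morph _ rhoD rho0). Qed.

(** The map [beta] embeds [B] in the total ring of fractions; its values [v b / t] are integral
    because [T] is the closure of [(t)]. *)
Lemma sring_integral (b : B) : exists n (c : 'I_n -> R),
  b ^+ n + \sum_(i < n) rho (c i) * b ^+ i = 0.
Proof.
have [d ed] := regular_denom regt.
have : carrier T (v b) by apply: (valP (b : submod T)).
rewrite closT -ed => /int_closure_principalP/asboolP/integralOver_equation[n [c e]].
exists n, c; pose beta (b : B) := qfrac (v b) d.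
have betaE a : to_frac (sval d) * beta a = to_frac (v a) by apply: qfracK.
have beta_inj a : beta a = 0 -> a = 0.
  move=> a0; apply: v_inj; apply: to_frac_inj; rewrite -betaE a0 mulr0.
  exact: (esym (rmorph0 (@to_frac R))).
have betaD a a' : beta (a + a') = beta a + beta a'.
  by apply: (@denom_frac_regular _ d); rewrite betaE mulrDr !betaE vD;
    apply: rmorphD.
have beta0 : beta 0 = 0.
  apply: (@denom_frac_regular _ d); rewrite betaE mulr0.
  exact: (rmorph0 (@to_frac R)).
have betaM a a' : beta (a * a') = beta a * beta a'.
  apply: (@denom_frac_regular _ d); apply: (@denom_frac_regular _ d).
  transitivity (to_frac (v a) * to_frac (v a')); last by rewrite -!betaE; ring.
  by rewrite betaE ed -!rmorphM vM.
have beta1 : beta 1 = 1.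
  by apply: (@denom_frac_regular _ d); rewrite betaE v1 ed mulr1.
have betaX a k : beta (a ^+ k) = beta a ^+ k.
  by elim: k => [|k IHk] //; rewrite !exprS betaM IHk.
have beta_rho r : beta (rho r) = to_frac r.
  apply: (@denom_frac_regular _ d); rewrite betaE -[v _]/(r * v 1) v1 ed.
  by rewrite -rmorphM mulrC.
apply: beta_inj; rewrite betaD betaX (big_morph _ betaD beta0).
rewrite -[RHS]e; congr (_ + _); apply: eq_bigr => i _.
by rewrite betaM beta_rho betaX.
Qed.

(** Otherwise some [u = s * rho r] is congruent to [1] modulo [P]. Scaling an integral equation of
    [s] by [rho r ^+ n] gives one of [u] whose lower coefficients come from [m]; replacing [u] by
    [1] puts [rho w] in [P] for a unit [w] in [1 + m]. *)
Lemma sring_maximal_lies_over (P : ideal B) r : maximal_ideal P -> r \in m ->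
  rho r \in P.
Proof.
move=> maxP mr; have idP := carrier_ideal P; have idm := carrier_ideal m.
apply: contrapT => /negP/(maximal_adjoin maxP)[y Py [s e]].
have [n [c e']] := sring_integral s; pose u := s * rho r.
have u1 k : 1 - u ^+ k \in P.
  elim: k => [|k IHk]; first by rewrite subrr; apply: (ideal0 idP).
  have -> : 1 - u ^+ k.+1 = u * (1 - u ^+ k) + y.
    by rewrite exprS /u -[X in X - _ = _]e; ring.
  by apply: (idealD idP) => //; apply: (idealM _ idP).
have ue : u ^+ n + \sum_(i < n) rho (c i * r ^+ (n - i)) * u ^+ i = 0.
  rewrite -[RHS](mulr0 (rho r ^+ n)) -[in RHS]e' mulrDr exprMn mulrC; congr (_ + _).
  rewrite mulr_sumr; apply: eq_bigr => i _; rewrite rhoM rhoX exprMn.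
  have -> : rho r ^+ n = rho r ^+ (n - i) * rho r ^+ i.
    by rewrite -exprD subnK // ltnW.
  by ring.
pose w := 1 + \sum_(i < n) c i * r ^+ (n - i).
have Pw : rho w \in P.
  rewrite rhoD rho1 rho_sum -[X in X \in _]subr0 -[X in _ - X]ue.
  rewrite opprD addrACA -sumrB; apply: (idealD idP); first exact: u1.
  apply: (ideal_sum (A := carrier P)) => // i _.
  by rewrite -{1}[rho _]mulr1 -mulrBr; apply: (idealM _ idP); apply: u1.
have mw : w \notin m.
  have [m1 _] := localR.1; apply/negP => mw; case/negP: m1.
  rewrite -[1](addrK (\sum_(i < n) c i * r ^+ (n - i))).
  apply: (idealB idm mw); apply: (ideal_sum (A := carrier m)) => // i _.
  by rewrite -(subnSK (ltn_ord i)) exprSr mulrA; apply: (idealM _ idm).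
have [z wz] := local_unit localR mw.
case: maxP => /negP P1 _; apply: P1.
by rewrite -rho1 -wz rhoM; apply: (idealMr _ idP).
Qed.

Definition independent_maximal k (P : 'I_k -> ideal B) :=
  (forall j, maximal_ideal (P j)) /\
  forall i j, i != j -> ~ {subset P i <= P j}.

(** [e j] is a product, over [i != j], of elements of [P i] outside [P j]; primality keeps it
    outside [P j]. *)
Lemma independent_maximal_separate k (P : 'I_k ->
  ideal B) : independent_maximal P ->
  exists e : 'I_k -> B, forall j, e j \notin P j /\ forall i, i != j -> e j \in P i.
Proof.
move=> [maxP sepP].
have /choice[x xP] (ij : 'I_k * 'I_k) :
    exists x, ij.1 != ij.2 -> x \in P ij.1 /\ x \notin P ij.2.
  have [_|nij] := eqVneq ij.1 ij.2; first by exists 0.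
  have /existsNP[y /not_implyP[Py /negP nPy]] := sepP _ _ nij.
  by exists y.
exists (fun j => \prod_(i | i != j) x (i, j)) => j; split.
  apply: prime_prod; first exact: maximal_prime.
  by move=> i nij; case: (xP (i, j) nij).
move=> i nij; rewrite (bigD1 i) //=; apply: (idealMr _ (carrier_ideal (P i))).
by case: (xP (i, j) nij).
Qed.

Hypothesis noethR : noetherian R.

(** Beyond the number [n] of generators of [T], the separating elements [e j] satisfy a relation
    modulo [m] with some [r j0] a unit. As [m] maps into every maximal ideal of [B] and the other
    [e j] lie in [P j0], so would [e j0]. *)
Lemma independent_maximal_bounded : exists n, forall k (P : 'I_k -> ideal B),
  independent_maximal P -> (k <= n)%N.
Proof.
have [n [g gen]] := noethR T; exists n => k P indP; rewrite leqNgt;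
  apply/negP => nk.
have [e eP] := independent_maximal_separate indP; have [maxP _] := indP.
have /choice[A eA] (j : 'I_k) : exists A : 'I_n -> R,
    e j = \sum_i A i *: (g i : sring redT) by apply: gen.
have [r [[j0 rj0] rA]] := local_relation localR A nk.
have idP := carrier_ideal (P j0).
have rhoE s (b : sring redT) : (s *: b : B) = rho s * b.
  by apply: v_inj; rewrite v_rho.
have sumP : \sum_j rho (r j) * e j \in P j0.
  have -> : \sum_j rho (r j) * e j = \sum_i rho (\sum_j r j * A j i) * (g i : B).
    under [RHS]eq_bigr do rewrite rho_sum mulr_suml.
    rewrite exchange_big; apply: eq_bigr => j _; rewrite eA mulr_sumr.
    by apply: eq_bigr => i _; rewrite rhoE rhoM mulrA.
  apply: (ideal_sum (A := carrier (P j0))) => // i _; apply: (idealMr _ idP).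
  exact: sring_maximal_lies_over.
have Pj0 : rho (r j0) * e j0 \in P j0.
  have -> : rho (r j0) * e j0 =
      \sum_j rho (r j) * e j - \sum_(j | j != j0) rho (r j) * e j.
    by rewrite [X in X - _](bigD1 j0) //= addrK.
  apply: (idealB idP sumP); apply: (ideal_sum (A := carrier (P j0))) => // j nj.
  by apply: (idealM _ idP); have [_] := eP j; apply; rewrite eq_sym.
have [u ru] := local_unit localR rj0; have [/negP nPe _] := eP j0; apply: nPe.
have -> : e j0 = rho u * (rho (r j0) * e j0).
  by rewrite mulrA -rhoM [u * _]mulrC ru rho1 mul1r.
by apply: (idealM _ idP); apply: Pj0.
Qed.

Variable (M : lmodType R).
Hypothesis traceM : trace M = carrier T.
Hypothesis actM : forall y (x : M), y \in T -> exists z, t *: z = y *: x.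

Let val_in (f : dual M) (x : M) : dual_app f x \in T.
Proof. by have := trace_mem f x; rewrite traceM. Qed.

Let app (f : dual M) (x : M) : B := (Submod (val_in f x) : submod T).

Let appE f x : v (app f x) = dual_app f x. Proof. by []. Qed.

Let act_dual (b : B) (f : dual M) : exists g, forall x, app g x = b * app f x.
Proof.
have glin (a : R) x y : v (b * app f (a *: x + y)) = a * v (b * app f x) + v (b
  * app f y).
  apply: regt; rewrite vM appE dual_linear [RHS]mulrDr [t * (a * _)]mulrCA !vM
    !appE.
  by ring.
by exists (mk_dual glin) => x; apply: v_inj; rewrite appE mk_dualE.
Qed.

Let image (f : dual M) : set B := fun b => exists x, app f x = b.

Let image_ideal f : is_ideal (image f).
Proof.
split; first by exists 0; apply: v_inj; rewrite appE dual0.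
move=> b _ _ [x <-] [y <-]; have [z e] := actM x (valP (b : submod T)).
exists (z + y); apply: v_inj; rewrite vD !appE dualD; congr (_ + _).
by apply: regt; rewrite vM appE -!dualZ e.
Qed.

Let sum_dual k (f : 'I_k -> dual M) x : app (\sum_j f j) x = \sum_j app (f j) x.
Proof.
elim/big_rec2: _ => [|j g h _ <-]; first by apply: v_inj.
by apply: v_inj.
Qed.

(** The values of the forms generate the unit ideal of [B], so some form [g j] has a value outside
    [P j]; in the sum of the [e j * g j] only the summand [j] survives modulo [P j]. *)
Let dual_avoiding k (P : 'I_k -> ideal B) : independent_maximal P ->
  exists f, forall j, exists x, app f x \notin P j.
Proof.
move=> indP; have [e eP] := independent_maximal_separate indP;
  have [maxP _] := indP.
have /choice[g gP] j : exists f, exists x, app f x \notin P j.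
  have idP := carrier_ideal (P j); apply: contrapT => /forallNP nf.
  have Pf f x : app f x \in P j.
    by apply: contrapT => /negP nP; apply: (nf f); exists x.
  have [Tt _ _] := redT; have : trace M t by rewrite traceM.
  case=> n [f [x tE]]; have [/negP P1 _] := maxP j; apply: P1.
  have -> : 1 = \sum_i app (f i) (x i).
    apply: v_inj; rewrite v1 tE; elim/big_rec2: _ => [|i y b _ ->] //.
  by apply: (ideal_sum (A := carrier (P j))) => // i _; apply: Pf.
have /choice[h hP] j := act_dual (e j) (g j).
exists (\sum_j h j) => j; have [x nPx] := gP j; exists x; rewrite sum_dual.
have idP := carrier_ideal (P j); have [_ pM] := maximal_prime (maxP j).
rewrite (bigD1 j) //=; apply/negP => Ps.
have : app (h j) x \in P j.
  rewrite -[app (h j) x](addrK (\sum_(i | i != j) app (h i) x)).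
  apply: (idealB idP Ps); apply: (ideal_sum (A := carrier (P j))) => // i nij.
  by rewrite hP; apply: (idealMr _ idP); have [_] := eP i; apply; rewrite eq_sym.
by rewrite hP => /pM; rewrite (negPf nPx) (negPf (eP j).1).
Qed.

(** If no form attains [t], every image is a proper ideal of [B]. A form whose image lies in none of
    the [P j] then has its image in a new maximal ideal [Q], and independent families outgrow their
    bound. *)
Lemma dual_attains : exists (f : dual M) (x : M), dual_app f x = t.
Proof.
apply: contrapT => /forallNP none; have [n bound] := independent_maximal_bounded.
suff [P /bound] : exists P : 'I_n.+1 -> ideal B, independent_maximal P by
  rewrite ltnn.
elim: (n.+1) => [|k [P indP]].
  by exists (fun=> mk_ideal (zero_ideal B)); split=> [[]|[]].
have [f fP] := dual_avoiding indP; have [maxP sepP] := indP.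
have [|Q maxQ fQ] := maximal_ideal_above (image_ideal f).
  by case=> x e; apply: (none f); exists x; rewrite -appE e v1.
have PQ j : ~ {subset Q <= P j}.
  by move=> QP; have [x /negP] := fP j; apply; apply: QP; apply: fQ; exists x.
exists (fun i => if unlift ord0 i is Some j then P j else Q); split.
  by move=> i; case: (unlift ord0 i).
move=> i j; case: (unliftP ord0 i) => [i' ->|->];
  case: (unliftP ord0 j) => [j' ->|->] //.
- by rewrite (inj_eq lift_inj) => /sepP.
- move=> _ sPQ; apply: (PQ i'); have [Q1 _] := maxQ.
  by have [_ maxPi] := maxP i'; apply: maxPi.
Qed.

End Semilocal.

(** * Reflexive modules over an Arf local ring *)

Section ArfReflexive.
Variables (R : comNzRingType) (m : ideal R).
Hypotheses (noethR : noetherian R) (arfR : arf_ring R) (localR : local_at m).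

Lemma reflexive_torsion_free (M : lmodType R) (a : R) (x : M) :
  reflexive_module M -> GRing.lreg a -> a *: x = 0 -> x = 0.
Proof.
move=> /reflexiveP[inj _] rega ax; apply: inj => f; apply: rega.
by rewrite -dualZ ax dual0 mulr0.
Qed.

(* If [t] generates a reduction of the trace ideal [T] of [M], the module
   [M = Hom (M^*, T)] is closed under multiplication by [y / t] for [y] in [T]. *)
Lemma reflexive_act (M : lmodType R) (t y : R) (x : M) : reflexive_module M ->
  GRing.lreg t -> stable (trace M) t -> trace M y -> exists z, t *: z = y *: x.
Proof.
move=> /reflexiveP[inj surj] regt stT Ty; have [q qP] := divisor_quotient t.
have qE f : t * q (y * dual_app f x) = y * dual_app f x.
  by apply: (qP (_ * _)); have [w _ e] := stT _ _ Ty (trace_mem f x); exists w.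
have [|z zP] := surj (fun f => q (y * dual_app f x)).
  move=> a f g; apply: regt; rewrite qE [RHS]mulrDr [t * (a * _)]mulrCA !qE.
  by rewrite -[dual_app (a *: f + g) x]/(a * dual_app f x + dual_app g x); ring.
exists z; apply/eqP; rewrite -subr_eq0; apply/eqP/inj => f.
by rewrite -scaleN1r dualD !dualZ -zP qE mulN1r subrr.
Qed.

(** The data of a splitting [M = B x (+) ker f] with [B = t^-1 T]: [f] sends [x] to the generator
    [t] of [T] over [B], and each [y / t] acts on [x]. *)
Lemma reflexive_split (M : lmodType R) :
  reflexive_module M -> has_regular (trace M) ->
  exists (t : R) (f : dual M) (x : M), [/\ GRing.lreg t, dual_app f x = t &
    forall y, trace M y -> exists z, t *: z = y *: x].
Proof.
move=> reflM regM; have idT := trace_is_ideal M.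
have [t [Tt regt eT stT]] :=
  int_closed_stable arfR idT (trace_int_closed arfR regM) regM.
have redT : [/\ t \in mk_ideal idT, GRing.lreg t & stable (carrier (mk_ideal
  idT)) t].
  by rewrite carrier_mk_ideal; split=> //; apply/(mk_idealP idT).
have [|||f [x fx]] := @dual_attains R m localR (mk_ideal idT) t redT _ noethR M.
- by rewrite carrier_mk_ideal.
- by rewrite carrier_mk_ideal.
- by move=> y x /(mk_idealP idT); apply: reflexive_act.
by exists t, f, x; split=> // y; apply: reflexive_act.
Qed.

Lemma trace_regular (I : ideal R) :
  has_regular (carrier I) -> has_regular (trace (submod I)).
Proof. by case=> x /sub_trace; exists x. Qed.

(** Since [x f(y) = f(x) y], the form [f] on [I] is multiplication by [t / x]; it reaches all of the
    trace ideal by [act]. *)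
Lemma reflexive_iso_trace (I : ideal R) :
  reflexive_module (submod I) -> has_regular (carrier I) ->
  module_iso (submod I) (submod (mk_ideal (trace_is_ideal (submod I)))).
Proof.
move=> reflI regI; have idT := trace_is_ideal (submod I).
have [t [f [x [regt fx act]]]] := reflexive_split reflI (trace_regular regI).
have regx : GRing.lreg (val x : R).
  move=> r s /= e; apply: regt; rewrite -fx mulrC [RHS]mulrC -!dualZ.
  by congr dual_app; apply: val_inj; rewrite !submodZ mulrC e mulrC.
apply: (ratio_iso regx regt) => [y Iy|y /(mk_idealP idT) Ty].
  exists (dual_app f (Submod Iy)).
    by apply/(mk_idealP (trace_is_ideal _)); apply: trace_mem.
  rewrite -fx mulrC -!dualZ; congr dual_app; apply: val_inj.
  by rewrite !submodZ mulrC.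
have [z e] := act y Ty; exists (val z); first exact: valP.
by rewrite -submodZ e submodZ mulrC.
Qed.

Lemma reflexive_trace_int_closed (I : ideal R) : m_primary m I ->
  (reflexive_module (submod I) <->
     exists J : ideal R, trace_ideal J /\ module_iso (submod I) (submod J)) /\
  ((exists J : ideal R, trace_ideal J /\ module_iso (submod I) (submod J)) <->
     exists J : ideal R,
       integrally_closed J /\ module_iso (submod I) (submod J)).
Proof.
move=> /(m_primary_regular localR arfR) regI.
have mkT (J : ideal R) : trace_ideal (mk_ideal (trace_is_ideal (submod J))).
  exists (submod J); split; first exact: noethR.
  by move=> x; split=> /(mk_idealP (trace_is_ideal _)).
have r_t : reflexive_module (submod I) ->
    exists J : ideal R, trace_ideal J /\ module_iso (submod I) (submod J).
  by move=> reflI; eexists; split; [apply: mkT | apply: reflexive_iso_trace].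
have t_c : (exists J : ideal R, trace_ideal J /\ module_iso (submod I) (submod
  J)) ->
    exists J : ideal R, integrally_closed J /\ module_iso (submod I) (submod J).
  case=> J [[M [_ JM]] IJ]; exists J; split=> //.
  have eJ : carrier J = trace M by apply/seteqP; split=> x /JM.
  rewrite /integrally_closed eJ trace_int_closed // -eJ.
  exact: iso_has_regular IJ regI.
have c_t : (exists J : ideal R, integrally_closed J /\ module_iso (submod I)
  (submod J)) ->
    exists J : ideal R, trace_ideal J /\ module_iso (submod I) (submod J).
  case=> J [/esym intJ IJ]; eexists; split; first exact: (mkT J).
  by apply: (module_iso_trans IJ); apply: int_closed_iso_trace => //;
    apply: iso_has_regular IJ regI.
split; split=> // /t_c[J [/esym intJ IJ]].
apply: (reflexive_iso (module_iso_sym IJ)); apply: int_closed_reflexive => //.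
exact: iso_has_regular IJ regI.
Qed.

End ArfReflexive.

(** * Zero-divisors when the integral closure is local *)

Section ZeroDivisors.
Variables (R : comNzRingType) (m : ideal R).
Hypotheses (noethR : noetherian R) (arfR : arf_ring R) (localR : local_at m).

(** Otherwise the elements [z ^+ n * (s - z * r)] with [s] regular form a multiplicative set
    avoiding [0]. For a prime [p] avoiding it, [p + (z)] has no regular element, so lies in a prime
    [q] of zero-divisors. As [z] is not in [p], the dimension forces [q] to contain [m], which has a
    regular element. *)
Lemma power_stabilizes (z : R) :
  exists n r s, GRing.lreg s /\ z ^+ n * s = z ^+ n.+1 * r.
Proof.
apply: contrapT => nstab.
pose S : set R := fun u => exists n r s, GRing.lreg s /\ u = z ^+ n * (s - z * r).
have [|||p [pp _ pS]] := @prime_ideal_avoiding R [set 0]%classic S (zero_ideal R).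
- move=> _ -> [n [r [s [regs e]]]]; apply: nstab; exists n, r, s; split=> //.
  by apply/eqP; rewrite -subr_eq0 exprSr -mulrA -mulrBr -e.
- by exists 0%N, 0, 1; split; [exact: lreg1 | rewrite mulr0 subr0 mulr1].
- move=> _ _ [n [r [s [regs ->]]]] [k [r' [s' [regs' ->]]]].
  exists (n + k)%N, (r * s' + s * r' - z * r * r'), (s * s'); split;
    first exact: lregM.
  by rewrite exprD; ring.
have idp := carrier_ideal p; have idz := ideal_adjoin_ideal z idp.
have [|||q [pq zq qreg]] :=
    @prime_ideal_avoiding R (ideal_adjoin (carrier p) z) (@GRing.lreg R) idz.
- move=> _ [y py [r ->]] regs; apply: (pS y py).
  by exists 0%N, r, (y + r * z); split=> //; rewrite mul1r [z * r]mulrC addrK.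
- exact: lreg1.
- by move=> x y; apply: lregM.
have [x mx regx] := arf_regular_element localR arfR.
apply: (qreg x) => //; apply: (prime_above_prime localR arfR pp pq _ _ mx).
  by move=> y py; apply: zq; apply: ideal_adjoin_sub.
move=> sqp; apply: (pS z); first by apply/sqp/zq/ideal_adjoin_mem.
by exists 1%N, 0, 1; split; [exact: lreg1 | rewrite mulr0 subr0 mulr1].
Qed.

Hypothesis local_int : local_ring (int_ring R).

(** A root of [X^2 - X] is integral, and in a local ring one of [E] and [1 - E] is a unit. *)
Lemma int_idempotent (e : total_frac R) : e * e = e -> e = 0 \/ e = 1.
Proof.
move=> ee; have [n localn] := local_int.
have inte : e \in @int_pred R.
  apply/asboolP; apply: (@integral_equation _ _ (@to_frac R) 2
    (fun i : 'I_2 => if i == ord0 then -1 else 0)) => //.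
    by case=> [[|i] ?]; [apply: integral_opp; apply: integral1 | apply: integral0].
  by rewrite big_ord_recl big_ord1 /= mul0r addr0 expr1 mulN1r expr2 ee subrr.
pose E : int_ring R := IntRing inte.
have EE : E * E = E by apply: val_inj.
have cases : E = 0 \/ E = 1.
  have [nE|nE] := boolP (E \in n); [left|right].
    have [n1 _] := localn.1.
    have [|u Eu] := local_unit localn (x := 1 - E).
      apply/negP => nE'; case/negP: n1.
      by rewrite -[1](subrK E); apply: (idealD (carrier_ideal n) nE' nE).
    by rewrite -[E]mulr1 -Eu mulrA mulrBr mulr1 EE subrr mul0r.
  have [u Eu] := local_unit localn nE.
  by rewrite -[E]mulr1 -Eu mulrA EE.
by case: cases => /(congr1 val) /= eE; [left|right].
Qed.

(** With [q = r / s] one has [Z ^+ n = Z ^+ n.+1 * q], so [(Z * q) ^+ n] is idempotent: if it is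
    [0], then [Z ^+ n = 0]; if it is [1], then [Z] is a unit and [z] is regular. *)
Lemma zero_divisor_nilpotent (z : R) : ~ GRing.lreg z -> exists n, z ^+ n = 0.
Proof.
move=> zdiv; have [n [r [s [regs e]]]] := power_stabilizes z.
have [d ds] := regular_denom regs.
pose Z := to_frac z; pose q := qfrac r d.
have Zn : Z ^+ n = Z ^+ n.+1 * q.
  apply: (@denom_frac_regular _ d); rewrite mulrCA qfracK mulrC ds.
  by rewrite /Z -!rmorphXn -!rmorphM e.
have Znk k : Z ^+ n * (Z * q) ^+ k = Z ^+ n.
  elim: k => [|k IHk]; first by rewrite mulr1.
  by rewrite exprSr mulrA IHk [RHS]Zn exprSr mulrA.
pose i := (Z * q) ^+ n.
have [] := @int_idempotent i.
- by rewrite {1 3}/i exprMn mulrAC Znk.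
- move=> i0; exists n; apply: to_frac_inj.
  rewrite rmorph0 rmorphXn -[LHS]/(Z ^+ n) -(Znk n) -/i i0.
  exact: mulr0.
rewrite /i => i1; exfalso; apply: zdiv.
have [w Zw] : exists w, Z * w = 1.
  (* For [n = 0] the idempotent is trivially [1], and the inverse comes from [Zn] instead. *)
  case: (n) Zn i1 => [|k] Zn i1; first by exists q; rewrite expr0 expr1 in Zn;
    rewrite -Zn.
  by exists (q * (Z * q) ^+ k); rewrite mulrA -exprS i1.
move=> a b /(congr1 (@to_frac R)); rewrite !rmorphM -/Z => eab; apply: to_frac_inj.
rewrite -[LHS]mul1r -[RHS]mul1r -Zw ![Z * w]mulrC -!mulrA.
by congr (w * _).
Qed.

Definition nilradical : set R := fun z => exists n, z ^+ n = 0.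

Lemma nilradical_ideal : is_ideal nilradical.
Proof.
split; first by exists 1%N; rewrite expr1.
move=> a x y [n xn] [k yk]; exists (n + k)%N; rewrite exprDn; apply: big1 => i _.
have [ki|ik] := leqP k i.
  by rewrite -(subnK ki) [_ ^+ (i - k + k)]exprD yk !mulr0 mul0rn.
have -> : (n + k - i = k - i + n)%N by rewrite -addnBA ?(ltnW ik) // addnC.
by rewrite exprD [(a * x) ^+ n]exprMn xn !mulr0 mul0r mul0rn.
Qed.

(** From [x] killed by the other elements, pass to [z ord0 ^+ k * x] with [k] the largest exponent
    leaving it nonzero. *)
Lemma nilpotents_annihilated n (z : 'I_n -> R) : (forall i, nilradical (z i)) ->
  exists2 x : R, x != 0 & forall i, z i * x = 0.
Proof.
elim: n z => [|n IHn] z zn; first by exists 1; [exact: oner_neq0 | case].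
have [x x0 zx] := IHn (fun i => z (lift ord0 i)) (fun i => zn _).
have ex : exists k, z ord0 ^+ k * x == 0.
  by have [k zk] := zn ord0; exists k; rewrite zk mul0r.
have [k /eqP zk mink] := ex_minnP ex; case: k zk mink => [|k] zk mink.
  by rewrite mul1r in zk; rewrite zk eqxx in x0.
exists (z ord0 ^+ k * x); first by apply/negP => /mink; rewrite ltnn.
move=> i; case: (unliftP ord0 i) => [j ->|->]; first by rewrite mulrCA zx mulr0.
by rewrite mulrA -exprS.
Qed.

(** The prime is the nilradical. Its finitely many generators are killed by some [x != 0], and the
    annihilator of [x] consists of zero-divisors, which are nilpotent. *)
Lemma associated_zero_divisors : exists p : ideal R,
  [/\ prime_ideal p, associated p & forall a : R, a \notin p -> GRing.lreg a].
Proof.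
have idN := nilradical_ideal; pose p := mk_ideal idN.
have pP (a : R) : reflect (nilradical a) (a \in p) := mk_idealP idN a.
have reg a : a \notin p -> GRing.lreg a.
  move=> pa; apply: contrapT => /zero_divisor_nilpotent na.
  by case/negP: pa; apply/pP.
have [n [g gen]] := noethR p.
have [|x x0 gx] := @nilpotents_annihilated n (fun i => val (g i)).
  by move=> i; apply/pP; apply: (valP (g i)).
have assoc : associated p.
  exists x => a; split=> [pa|ax].
    suff : val (Submod pa : submod p) * x = 0 by [].
    have [c ->] := gen (Submod pa).
    elim/big_rec: _ => [|i u _ ux]; first by rewrite mul0r.
    by rewrite -[val _]/(c i * val (g i) + val u) mulrDl ux -mulrA gx mulr0 addr0.
  apply: contrapT => /negP/reg rega; case/eqP: x0.
  by apply: rega; rewrite ax mulr0.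
exists p; split=> //; split.
  by apply/pP => -[k /eqP]; rewrite expr1n oner_eq0.
move=> a b; have [//|pa] := boolP (a \in p) => /pP[k]; rewrite exprMn => abk.
by apply/pP; exists k; apply: (lregX (n := k) (reg _ pa)); rewrite mulr0.
Qed.

End ZeroDivisors.

(** * Modules with a rank *)

(** A basis over the total ring of fractions, chosen inside [M]; this form of the rank descends to
    kernels without a new localization. *)
Definition torsion_basis (R : comNzRingType) (M : lmodType R) (l : nat) :=
  exists e : 'I_l -> M,
    (forall c : 'I_l -> R, \sum_i c i *: e i = 0 -> forall i, c i = 0) /\
    forall x, exists (s : R) (c : 'I_l -> R),
      GRing.lreg s /\ s *: x = \sum_i c i *: e i.

Section LocalizedBasis.
Variables (R : comNzRingType) (S : mult_set R) (M : lmodType R).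
Hypothesis regS : forall s, s \in ms_pred S -> GRing.lreg s.

Let loc (x : M) : locm S M := locfrac x (denom1 S).

Let locD x y : loc (x + y) = loc x + loc y.
Proof. by rewrite loc_addfE; apply: loc_eq; rewrite /= !scale1r mul1r scale1r. Qed.

Let locZ a x : to_loc S a *: loc x = loc (a *: x).
Proof. by rewrite [LHS]loc_scaleE; apply: loc_eq; rewrite /= mul1r. Qed.

Let loc_sum (I : finType) (f : I -> M) : loc (\sum_i f i) = \sum_i loc (f i).
Proof. exact: (big_morph loc locD erefl). Qed.

Let loc_denom (x : M) (s : denom S) : to_loc S (sval s) *: locfrac x s = loc x.
Proof.
by rewrite [LHS]loc_scaleE; apply: loc_eq; rewrite /= mul1r scale1r.
Qed.

Let inv (s : denom S) : locr S := locfrac (1 : R^o) s.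

Let loc_denomV (x : M) (s : denom S) : inv s *: loc x = locfrac x s.
Proof.
by rewrite [LHS]loc_scaleE; apply: loc_eq; rewrite /= mulr1 scale1r.
Qed.

Let common_denominator l (q : 'I_l -> locr S) : exists s (b : 'I_l -> R),
  s \in ms_pred S /\ forall i, to_loc S s * q i = to_loc S (b i).
Proof.
have [S1 SM] := ms_closed S.
have /choice[a aP] i : exists a : R * denom S, to_loc S (sval a.2) * q i =
  to_loc S a.1.
  have [x [s ->]] := locfracP (q i); exists (x, s).
  rewrite [LHS]loc_scaleE; apply: loc_eq.
  by rewrite /= mul1r scale1r.
exists (\prod_i sval (a i).2), (fun i => (a i).1 * \prod_(j | j != i) sval (a j).2).
split; first by elim/big_ind: _ => // i _; apply: (svalP (a i).2).
by move=> i; rewrite (bigD1 i) //= mulrC rmorphM mulrA [q i * _]mulrC aP -rmorphM.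
Qed.

(** Numerators of a basis of the localization serve as [e]. Since [S] consists of regular elements,
    a coefficient vanishing in the localization vanishes in [R], and equalities in the localized
    module hold in [M] up to a regular factor. *)
Lemma free_torsion_basis l : free_of_rank (locm S M) l -> torsion_basis M l.
Proof.
case/module_iso_inverse=> f [g [fK gK]]; have [S1 SM] := ms_closed S.
pose h i := g (delta_mx 0 i).
have hE v : v = \sum_i (f v) 0 i *: h i.
  rewrite -[LHS]fK {1}[f v]row_sum_delta linear_sum; apply: eq_bigr => i _.
  by rewrite linearZ.
have indep c : \sum_i c i *: h i = 0 -> forall i, c i = 0.
  move=> /(congr1 f)/rowP e i; have := e i; rewrite linear0 linear_sum mxE summxE.
  rewrite (bigD1 i) //= big1 => [|j nji]; rewrite linearZ /= gK !mxE !eqxx.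
    by rewrite mulr1 addr0.
  by rewrite eq_sym (negPf nji) mulr0.
have /choice[es esP] i : exists es : M * denom S, h i = locfrac es.1 es.2.
  by have [x [s ->]] := locfracP (h i); exists (x, s).
pose e i := (es i).1; pose s i := (es i).2.
have he i : loc (e i) = to_loc S (sval (s i)) *: h i by rewrite esP loc_denom.
exists e; split.
  move=> c c0 i.
  have : \sum_i to_loc S (c i * sval (s i)) *: h i = 0.
    rewrite -[RHS]/(loc 0) -c0 loc_sum; apply: eq_bigr => j _.
    by rewrite -locZ he scalerA -rmorphM.
  move=> /indep/(_ i)/locfrac_eq[u /regS regu] /=.
  rewrite !scale1r scaler0 => e0.
  have regs := regS (svalP (s i)).
  by apply: (lregM regu regs); rewrite mulr0 -mulrA [_ * c i]mulrC.
(* [h i] is [loc (e i)] divided by [s i], whence the factor [inv (s i)]. *)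
move=> x; have [u [b [Su ub]]] := common_denominator
  (fun i => f (loc x) 0 i * inv (s i)).
have : loc (u *: x) = loc (\sum_i b i *: e i).
  rewrite -locZ loc_sum [loc x]hE scaler_sumr; apply: eq_bigr => i _.
  by rewrite -locZ -ub -!scalerA loc_denomV esP.
move=> /locfrac_eq[w Sw] /=; rewrite !scale1r => e'.
exists (w * u), (fun i => w * b i); split; first by apply: regS; apply: SM.
rewrite -scalerA e' scaler_sumr; apply: eq_bigr => i _.
by rewrite scalerA.
Qed.

End LocalizedBasis.

(** * Splitting off trace ideals *)

Section DualKernel.
Variables (R : comNzRingType) (M : lmodType R) (f : dual M).

Definition dual_ker : {pred M} := fun x => `[< dual_app f x = 0 >].

Lemma dual_ker_closed : submod_closed dual_ker.
Proof.
split=> [|a x y /asboolP fx /asboolP fy]; apply/asboolP; first exact: dual0.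
by rewrite dual_linear fx fy mulr0 addr0.
Qed.
HB.instance Definition _ := GRing.isSubmodClosed.Build R M dual_ker dual_ker_closed.

Definition kernel : lmodType R := submod dual_ker.

Definition kernel_val (x : kernel) : M := submod_val x.

Lemma kernel_val_linear : linear kernel_val. Proof. by []. Qed.

Lemma kernel_val_inj : injective kernel_val. Proof. exact: val_inj. Qed.

Lemma kernelP (x : M) : dual_app f x = 0 -> exists k : kernel, kernel_val k = x.
Proof.
move=> fx; have kx : x \in dual_ker by apply/asboolP.
by exists (Submod kx).
Qed.

Lemma dual_kernel (k : kernel) : dual_app f (kernel_val k) = 0.
Proof. by apply/asboolP; apply: (valP k). Qed.

End DualKernel.

Section SplitSummand.
Variables (R : comNzRingType) (M : lmodType R) (f : dual M) (t : R) (x0 : M).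
Hypotheses (reflM : reflexive_module M) (regt : GRing.lreg t).
Hypothesis act : forall y, trace M y -> exists z, t *: z = y *: x0.
Hypothesis fx0 : dual_app f x0 = t.

Let tI (x y : M) : t *: x = t *: y -> x = y.
Proof.
move=> e; apply/eqP; rewrite -subr_eq0; apply/eqP.
by apply: (reflexive_torsion_free reflM regt); rewrite scalerBr e subrr.
Qed.

(** [s y] stands for [(y / t) x0], a section of [f] over the trace ideal; elsewhere its value is
    arbitrary. *)
Lemma trace_section : exists s : R -> M, forall y, trace M y ->
  t *: s y = y *: x0 /\ dual_app f (s y) = y.
Proof.
have /choice[s sP] y : exists z, trace M y -> t *: z = y *: x0.
  have [/act[z e]|nT] := pselect (trace M y); last by exists 0.
  by exists z.
exists s => y Ty; split; first exact: sP.
by apply: regt; rewrite -dualZ sP // dualZ fx0 mulrC.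
Qed.

(** The projection is [x - (f(x) / t) x0], stated after multiplication by [t], which [tI]
    cancels. *)
Lemma kernel_projection : exists p : {linear M -> kernel f}, forall x,
  t *: kernel_val (p x) = t *: x - dual_app f x *: x0.
Proof.
have [s sP] := trace_section.
have /choice[p pP] x : exists k : kernel f, kernel_val k = x - s (dual_app f x).
  apply: kernelP; rewrite -scaleN1r dualD dualZ.
  by have [_ ->] := sP _ (trace_mem f x); rewrite mulN1r subrr.
have pE x : t *: kernel_val (p x) = t *: x - dual_app f x *: x0.
  by rewrite pP scalerBr; have [->] := sP _ (trace_mem f x).
have [|q qp] := @linear_intro _ _ _ p; last by exists q => x; rewrite qp pE.
move=> a x y; apply/kernel_val_inj/tI; rewrite kernel_val_linear scalerDr.
rewrite [t *: (a *: _)]scalerA mulrC -scalerA !pE dual_linear.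
by rewrite !scalerDr scalerDl opprD scalerN !scalerA [a * t]mulrC addrACA.
Qed.

Lemma kernel_reflexive : reflexive_module (kernel f).
Proof.
have [p pP] := kernel_projection.
have [i iE] := linear_intro (@kernel_val_linear _ _ f).
apply: (reflexive_retract (i := i) (p := p)) reflM => k.
by apply/kernel_val_inj/tI; rewrite pP !iE dual_kernel scale0r subr0.
Qed.

(** The isomorphism puts [f x] in coordinate [ord0] and the coordinates of [p x] in the others; the
    section [s] and the inverse [h] provide preimages. *)
Lemma split_dsum n (I : 'I_n -> ideal R) :
  module_iso (kernel f) (submod (dsum I)) ->
  module_iso M (submod (dsum (fun i : 'I_n.+1 =>
    if unlift ord0 i is Some j then I j else mk_ideal (trace_is_ideal M)))).
Proof.
set I' := fun i : 'I_n.+1 => _; case/module_iso_inverse=> g [h [gK hK]].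
have idT := trace_is_ideal M; have [p pP] := kernel_projection.
pose row x : 'rV[R]_n.+1 := \row_i if unlift ord0 i is Some j
  then (val (g (p x)) : 'rV[R]_n) 0 j else dual_app f x.
have row_in x : row x \in dsum I'.
  apply/forallP => i; rewrite mxE /I'; case: (unlift ord0 i) => [j|].
    by have /forallP := valP (g (p x)); apply.
  by apply/(mk_idealP idT); apply: trace_mem.
pose F x : submod (dsum I') := Submod (row_in x).
have row0 x : row x 0 ord0 = dual_app f x by rewrite mxE unlift_none.
have rowS x j : row x 0 (lift ord0 j) = (val (g (p x)) : 'rV[R]_n) 0 j.
  by rewrite mxE liftK.
have F_linear : linear F.
  move=> a x y; apply/val_inj/rowP => i.
  rewrite -[RHS]/((a *: row x + row y) 0 i) [RHS]mxE [(a *: row x) 0 i]mxE.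
  rewrite -[LHS]/(row (a *: x + y) 0 i).
  case: (unliftP ord0 i) => [j ->|->]; last by rewrite !row0 dual_linear.
  by rewrite !rowS !linearP !mxE.
apply: (module_iso_intro F_linear); apply: inj_surj_bij.
  move=> x y /(congr1 val) /= /rowP e.
  have e0 : dual_app f x = dual_app f y by have := e ord0; rewrite !row0.
  have ep : p x = p y.
    apply: (can_inj gK); apply/val_inj/rowP => j.
    by have := e (lift ord0 j); rewrite !rowS.
  apply: tI; have := pP x; rewrite ep pP e0 => /(congr1 (+%R^~ (dual_app f y *:
    x0))).
  by rewrite !subrK.
have [s sP] := trace_section.
move=> u; have /forallP uI := valP u; pose u' : 'rV[R]_n.+1 := val u.
have Ty : trace M (u' 0 ord0).
  by apply/(mk_idealP idT); have := uI ord0; rewrite /I' unlift_none.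
pose w : 'rV[R]_n := \row_j u' 0 (lift ord0 j).
have wI : w \in dsum I.
  by apply/forallP => j; rewrite mxE; have := uI (lift ord0 j); rewrite /I' liftK.
pose k := h (Submod wI); exists (s (u' 0 ord0) + kernel_val k).
have [ts fs] := sP _ Ty.
have fx : dual_app f (s (u' 0 ord0) + kernel_val k) = u' 0 ord0.
  by rewrite dualD fs dual_kernel addr0.
have px : p (s (u' 0 ord0) + kernel_val k) = k.
  by apply/kernel_val_inj/tI; rewrite pP fx scalerDr ts addrC addKr.
apply/val_inj/rowP => i; rewrite -[LHS]/(row _ 0 i) -[RHS]/(u' 0 i).
case: (unliftP ord0 i) => [j ->|->]; last by rewrite row0.
by rewrite rowS px hK /= mxE.
Qed.

End SplitSummand.

Section Decomposition.
Variables (R : comNzRingType) (m p : ideal R).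
Hypotheses (noethR : noetherian R) (arfR : arf_ring R) (localR : local_at m).
Hypotheses (pp : prime_ideal p) (assp : associated p).
Hypothesis regp : forall a : R, a \notin p -> GRing.lreg a.

Lemma regular_notin (a : R) : GRing.lreg a -> a \notin p.
Proof.
have [x xP] := assp => rega; apply/negP => /xP ax.
have x0 : x = 0 by apply: rega; rewrite ax mulr0.
by case: pp => /negP p1 _; apply: p1; apply/xP; rewrite x0 mulr0.
Qed.

(** Let [x] have annihilator [p]. Independence makes [x *: e ord0] nonzero, and some form detects
    it; the value of that form at [e ord0], not killed by [x], lies outside [p], hence is
    regular. *)
Lemma torsion_basis_trace (M : lmodType R) l : reflexive_module M ->
  torsion_basis M l.+1 -> has_regular (trace M).
Proof.
move=> /reflexiveP[inj _] [e [indep _]]; have [x xP] := assp.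
have xe : x *: e ord0 <> 0.
  move=> xe; have := indep (fun i => if i == ord0 then x else 0).
  rewrite (bigD1 ord0) //= xe add0r big1 => [|i /negPf->]; last by rewrite scale0r.
  move=> /(_ erefl ord0); rewrite eqxx => x0.
  by case: pp => /negP p1 _; apply: p1; apply/xP; rewrite x0 mulr0.
have /existsNP[f fx] : ~ forall f, dual_app f (x *: e ord0) = 0 by move/inj.
exists (dual_app f (e ord0)); first exact: trace_mem.
by apply: regp; apply/negP => /xP fe; apply: fx; rewrite dualZ mulrC.
Qed.

(** As [f x] is regular, some [d = f (e i0)] lies outside [p]. Eliminating [e i0] moves [d] times
    each other basis vector into the kernel, and the results form the new basis. *)
Lemma kernel_torsion_basis (M : lmodType R) l (f : dual M) (x : M) :
  GRing.lreg (dual_app f x) -> torsion_basis M l.+1 -> torsion_basis (kernel f) l.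
Proof.
move=> regx [e [indep span]]; have idp := carrier_ideal p.
have [i0 /regp regd] : exists i0, dual_app f (e i0) \notin p.
  apply: contrapT => /forallNP nf; have [s [c [regs /(congr1 (dual_app f))]]]
    := span x.
  rewrite dualZ => sx; case/negP: (regular_notin (lregM regs regx)); rewrite sx.
  elim/big_rec: _ => [|i u _ pu]; first by rewrite dual0; apply: (ideal0 idp).
  rewrite dual_linear; apply: (idealD idp) pu; apply: (idealM _ idp).
  by apply: contrapT => /negP/(nf i).
pose d := dual_app f (e i0).
have /choice[k kE] (j : 'I_l) : exists k : kernel f,
    kernel_val k = d *: e (lift i0 j) - dual_app f (e (lift i0 j)) *: e i0.
  by apply: kernelP; rewrite -scaleN1r dualD !dualZ mulN1r mulrC subrr.
have val_sum (c : 'I_l -> R) :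
    kernel_val (\sum_j c j *: k j) = \sum_j c j *: kernel_val (k j).
  elim/big_rec2: _ => // j u y _ <-; exact: kernel_val_linear.
have sumE (c : 'I_l -> R) : \sum_j c j *: kernel_val (k j) =
    \sum_j (c j * d) *: e (lift i0 j) - (\sum_j c j * dual_app f (e (lift i0
      j))) *: e i0.
  rewrite scaler_suml -sumrB; apply: eq_bigr => j _.
  by rewrite kE scalerBr !scalerA.
exists k; split.
  move=> c c0 j; have := indep (fun i => if unlift i0 i is Some j then c j * d
    else - \sum_j c j * dual_app f (e (lift i0 j))).
  rewrite (bigD1_ord i0) //= unlift_none scaleNr addrC.
  under eq_bigr do rewrite liftK.
  rewrite -sumE -val_sum c0 => /(_ erefl (lift i0 j)); rewrite liftK mulrC => cd.
  by apply: regd; rewrite mulr0.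
move=> y; have [s [c [regs e']]] := span (kernel_val y).
exists (d * s), (fun j => c (lift i0 j)); split; first exact: lregM.
apply: kernel_val_inj; rewrite val_sum sumE.
rewrite -[kernel_val (_ *: _)]/((d * s) *: kernel_val y) -scalerA e'.
(* Applying [f] to the relation for [y] expresses [c i0 * d] by the other coefficients, as [sumE]
   requires of the coefficient of [e i0]. *)
have : \sum_i c i * dual_app f (e i) = 0.
  have := dual_kernel y; move/(congr1 (dual_app f)): e'; rewrite dualZ => + y0.
  rewrite y0 mulr0 => e0; rewrite [RHS]e0; elim/big_rec2: _ => [|i u z _ ->];
    first by rewrite dual0.
  by rewrite dual_linear.
rewrite !(bigD1_ord i0) //= -/d => /(canRL (addrK _)); rewrite add0r => e0.
rewrite scalerDr scaler_sumr scalerA addrC; congr (_ + _).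
  by apply: eq_bigr => j _; rewrite scalerA mulrC.
by rewrite -scaleNr -e0 mulrC.
Qed.

Lemma reflexive_decomposition l (M : lmodType R) : reflexive_module M ->
  torsion_basis M l -> exists (n : nat) (I : 'I_n -> ideal R),
    (forall i, integrally_closed (I i) /\ m_primary_or_unit m (I i)) /\
    module_iso M (submod (dsum I)).
Proof.
elim: l M => [|l IHl] M reflM basisM.
  (* The index type is empty and [p] is a placeholder. Without basis vectors every element is
     torsion, hence zero by reflexivity. *)
  exists 0%N, (fun i => p); split; first by case.
  have M0 (x : M) : x = 0.
    have [e [_ span]] := basisM; have [s [c [regs]]] := span x.
    by rewrite big_ord0; apply: reflexive_torsion_free.
  apply: (@module_iso_intro _ _ _ (fun=> 0)).
    by move=> a x y; rewrite scaler0 addr0.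
  exists (fun=> 0) => x; first by rewrite (M0 x).
  by apply/val_inj/rowP; case.
have regT := torsion_basis_trace reflM basisM.
have [t [f [x [regt fx act]]]] := reflexive_split noethR arfR localR reflM regT.
have [n [I [IP iso]]] : exists (n : nat) (I : 'I_n -> ideal R),
    (forall i, integrally_closed (I i) /\ m_primary_or_unit m (I i)) /\
    module_iso (kernel f) (submod (dsum I)).
  apply: IHl; first exact: (kernel_reflexive reflM regt act fx).
  by apply: (kernel_torsion_basis (x := x)) basisM; rewrite fx.
have iso' := split_dsum reflM regt act fx iso.
exists n.+1; exists (fun i => if unlift ord0 i is Some j then I j
  else mk_ideal (trace_is_ideal M)); split; last exact: iso'.
move=> i; case: (unlift ord0 i) => [j|]; first exact: IP.
have idT := trace_is_ideal M; split.
  by rewrite /integrally_closed carrier_mk_ideal trace_int_closed.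
have [y Ty regy] := regT; apply: (regular_m_primary localR arfR _ regy).
exact/(mk_idealP idT).
Qed.

End Decomposition.

Theorem theorem1p2 (R : comNzRingType) (m : ideal R)
  (noethR : noetherian R) (arfR : arf_ring R) (localR : local_at m) :
  (forall I : ideal R, m_primary m I ->
    (reflexive_module (submod I) <->
       exists J : ideal R, trace_ideal J /\ module_iso (submod I) (submod J)) /\
    ((exists J : ideal R, trace_ideal J /\ module_iso (submod I) (submod J)) <->
       exists J : ideal R,
         integrally_closed J /\ module_iso (submod I) (submod J)))
  /\
  (local_ring (int_ring R) ->
   forall M : lmodType R, fin_gen M -> reflexive_module M -> positive_rank M ->
   exists (n : nat) (I : 'I_n -> ideal R),
     (forall i, integrally_closed (I i) /\
                m_primary_or_unit m (I i)) /\
     module_iso M (submod (dsum I))).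
Proof.
split=> [I|local_int M _ reflM [l _ rankM]].
  exact: reflexive_trace_int_closed.
have [p [pp assp regp]] := associated_zero_divisors noethR arfR localR local_int.
apply: (reflexive_decomposition noethR arfR localR pp assp regp reflM (l := l)).
(* The complement of [p] consists of regular elements, so the rank at this one associated prime
   already gives a torsion basis. *)
exact: (free_torsion_basis _ (rankM p pp assp)).
Qed.
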